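(* Let $F$ be a $\lambda\mu$-term and $z_1,\dots,z_n$ distinct variables, and let $\{M_{ij}\}_{1\le i\ne j\le n}$ and $\{N_i\}_{1\le i\le n}$ be $\lambda\mu$-terms such that, for every $\lambda\mu$-term $Z$ and every $i=1,\dots,n$, $$(\lambda z_1\dots z_n.F)\,M_{i1}\cdots M_{i(i-1)}\,Z\,M_{i(i+1)}\cdots M_{in}\equiv_{\mathcal T}N_i.$$ Then $(\lambda z_1\dots z_n.F)Z_1\cdots Z_n\equiv_{\mathcal T}N_1$ for all $\lambda\mu$-terms $Z_1,\dots,Z_n$.
   Context: Fix disjoint countably infinite sets of variables and names. $\lambda\mu$-terms: $M::=x\mid\lambda x.M\mid MM\mid\mu\alpha.{}_\beta|M|$, up to renaming of bound variables and names. Resource terms and sums. - Resource terms: $t::=x\mid\lambda x.t\mid t[t_1,\dots,t_n]\mid\mu\alpha.{}_\beta|t|$, with bags finite multisets; $1$ is the empty bag and $*$ is union. - Sums are finite sets with idempotent $+$ and empty sum $0$; constructors extend multilinearly, and $0$ annihilates. - A weak composition (w.c.) of a bag $B$ is a tuple of possibly empty bags whose union is $B$. Linear substitution $t\langle B/x\rangle$: - $x\langle[v]/x\rangle=v$, and $x\langle B/x\rangle=0$ otherwise. - For $y\ne x$: $y\langle1/x\rangle=y$, and $y\langle B/x\rangle=0$ if $B\ne1$. - It commutes with $\lambda y$ and with $\mu\alpha.{}_\beta|\cdot|$. - $(t[v_1..v_n])\langle B/x\rangle=\sum_{(B_0..B_n)\text{ w.c.}}t\langle B_0/x\rangle[v_i\langle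 B_i/x\rangle]_i$. Linear named application $\langle t\rangle_\alpha B$: - $\langle x\rangle_\alpha1=x$, and $\langle x\rangle_\alpha B=0$ if $B\ne1$. - It commutes with $\lambda y$ and with $\mu\gamma$. - $\langle{}_\eta|t|\rangle_\alpha B={}_\eta|\langle t\rangle_\alpha B|$ ($\eta\ne\alpha$), and $\langle{}_\alpha|t|\rangle_\alpha B=\sum_{(B_1,B_2)\text{ w.c.}}{}_\alpha|(\langle t\rangle_\alpha B_1)B_2|$. - $\langle t[v_1..v_n]\rangle_\alpha B=\sum_{(B_0..B_n)}(\langle t\rangle_\alpha B_0)[\langle v_i\rangle_\alpha B_i]_i$. Resource reduction. $\to_r$ is the closure under single-hole resource contexts of $(\lambda x.t)B\to t\langle B/x\rangle$, $(\mu\alpha.{}_\beta|t|)B\to\mu\alpha.\langle{}_\beta|t|\rangle_\alpha B$, and $\mu\gamma.{}_\alpha|\mu\beta.{}_\eta|t||\to\mu\gamma.({}_\eta|t|)\{\alpha/\beta\}$, extended to sums by $t+\mathcal S\to_r\mathcal T+\mathcal S$ if $t\to_r\mathcal T$ and $t\notin\mathcal S$. It is confluent and strongly normalising; $\mathrm{nf}_r(t)$ is the normal form of $t$. Taylor expansion. - $\mathcal T(x)=\{x\}$, $\mathcal T(\lambda x.M)=\{\lambda x.t\mid t\in\mathcal T(M)\}$, $\mathcal T(\mu\alpha.{}_\beta|M|)=\{\mu\alpha.{}_\beta|t|\mid t\in\mathcal T(M)\}$. - $\mathcal T(MN)=\{t[u_1..u_n]\mid t\in\mathcal T(M),n\ge0,u_i\in\mathcal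 T(N)\}$. - $\mathrm{NF}(\mathcal T(M))=\bigcup_{t\in\mathcal T(M)}\mathrm{nf}_r(t)$. - $M\equiv_{\mathcal T}N$ iff $\mathrm{NF}(\mathcal T(M))=\mathrm{NF}(\mathcal T(N))$. *)

(* Defs.v *)
From HB Require Import structures.
From mathcomp Require Import all_boot finmap multiset.
From mathcomp Require Import boolp classical_sets cardinality.
From Stdlib Require Import Relation_Operators.

Set Implicit Arguments.
Unset Strict Implicit.
Unset Printing Implicit Defensive.

Local Open Scope mset_scope.
Local Open Scope classical_set_scope.
Local Open Scope nat_scope.

(** Terms up to renaming of bound variables and names are de Bruijn terms, with
    two independent index spaces: [Lam] binds variable 0 of its body, and
    [Mu b M], standing for mu alpha. b|M|, binds name 0 both in [M] and in [b]
    (so [b = 0] means b = alpha). *)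

Inductive lterm : Type :=
| Var of nat
| Lam of lterm
| App of lterm & lterm
| Mu of nat & lterm.

Definition lams (n : nat) (F : lterm) : lterm := iter n Lam F.
Definition apps (M : lterm) (Ns : seq lterm) : lterm := foldl App M Ns.

(** Resource terms. [praw] has lists for bags; [rterm] keeps the terms all of
    whose bags are sorted for a fixed total order, that is, one representative
    for each class up to permutation of the bags. The constructor [rapp] takes
    a genuine finite multiset; see [rapp_inj] and [rterm_ind'] below. *)

Inductive praw : Type :=
| PVar of nat
| PLam of praw
| PApp of praw & seq praw
| PMu of nat & praw.

Fixpoint praw_enc (t : praw) : GenTree.tree nat :=
  match t with
  | PVar i => GenTree.Leaf i
  | PLam t => GenTree.Node 0 [:: praw_enc t]
  | PApp t vs => GenTree.Node 1 (praw_enc t :: map praw_enc vs)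
  | PMu b t => GenTree.Node 2 [:: GenTree.Leaf b; praw_enc t]
  end.

Fixpoint praw_dec (u : GenTree.tree nat) : praw :=
  match u with
  | GenTree.Leaf i => PVar i
  | GenTree.Node 0 [:: t] => PLam (praw_dec t)
  | GenTree.Node 1 (t :: vs) => PApp (praw_dec t) (map praw_dec vs)
  | GenTree.Node 2 [:: GenTree.Leaf b; t] => PMu b (praw_dec t)
  | _ => PVar 0
  end.

Fixpoint praw_ind' (P : praw -> Prop)
    (hV : forall i, P (PVar i))
    (hL : forall t, P t -> P (PLam t))
    (hA : forall t vs, P t -> foldr (fun v Q => P v /\ Q) True vs ->
            P (PApp t vs))
    (hM : forall b t, P t -> P (PMu b t)) (t : praw) : P t :=
  let rec := praw_ind' hV hL hA hM in
  match t with
  | PVar i => hV i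
  | PLam t => hL t (rec t)
  | PApp t vs => hA t vs (rec t)
      ((fix go vs : foldr (fun v Q => P v /\ Q) True vs :=
          match vs with
          | [::] => I
          | v :: vs => conj (rec v) (go vs)
          end) vs)
  | PMu b t => hM b t (rec t)
  end.

Lemma praw_encK : cancel praw_enc praw_dec.
Proof.
elim/praw_ind' => [i|t /= ->|t vs /= -> IH|b t /= ->] //=; congr PApp.
by elim: vs IH => //= v vs IHvs [-> /IHvs ->].
Qed.

HB.instance Definition _ := Countable.copy praw (can_type praw_encK).

Definition praw_le : rel praw := fun t u => choice.pickle t <= choice.pickle u.

Lemma praw_le_total : total praw_le.
Proof. by move=> t u; apply: leq_total. Qed.
Lemma praw_le_trans : transitive praw_le.
Proof. by move=> t u v; apply: leq_trans. Qed.
Lemma praw_le_anti : antisymmetric praw_le.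
Proof. by move=> t u tu; apply: (pcan_inj choice.pickleK); apply: anti_leq. Qed.

Fixpoint sorted_bags (t : praw) : bool :=
  match t with
  | PVar _ => true
  | PLam t => sorted_bags t
  | PApp t vs => [&& sorted_bags t, all sorted_bags vs & sorted praw_le vs]
  | PMu _ t => sorted_bags t
  end.

Record rterm : Type := RTerm { rval :> praw; rvalP : sorted_bags rval }.

HB.instance Definition _ := [isSub for rval].
HB.instance Definition _ := [Countable of rterm by <:].

Notation bag := {mset rterm}.

Definition rvar (i : nat) : rterm := @RTerm (PVar i) erefl.
Definition rlam (t : rterm) : rterm := @RTerm (PLam t) (rvalP t).
Definition rmu (b : nat) (t : rterm) : rterm := @RTerm (PMu b t) (rvalP t).

Lemma rapp_subproof (t : rterm) (B : bag) :
  sorted_bags (PApp t (sort praw_le [seq rval u | u <- B])).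
Proof.
rewrite /= rvalP all_sort sort_sorted ?andbT; last exact: praw_le_total.
by apply/allP => _ /mapP[u _ ->]; apply: rvalP.
Qed.

Definition rapp (t : rterm) (B : bag) : rterm := RTerm (rapp_subproof t B).

Lemma rapp_inj (t u : rterm) (B C : bag) :
  rapp t B = rapp u C -> t = u /\ B = C.
Proof.
move=> /(congr1 rval)[/val_inj -> eBC]; split=> //.
rewrite -[B]seq_mset_id -[C]seq_mset_id; apply/eq_seq_msetP.
apply: (perm_map_inj val_inj).
by rewrite -(perm_sort praw_le) eBC perm_sort.
Qed.

Lemma rvar_inj : injective rvar.
Proof. by move=> i j /(congr1 rval)[]. Qed.
Lemma rlam_inj : injective rlam.
Proof. by move=> t u /(congr1 rval)[/val_inj]. Qed.
Lemma rmu_inj (b c : nat) (t u : rterm) : rmu b t = rmu c u -> b = c /\ t = u.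
Proof. by move=> /(congr1 rval)[-> /val_inj ->]. Qed.

Lemma rterm_ind' (P : rterm -> Prop) :
  (forall i, P (rvar i)) ->
  (forall t, P t -> P (rlam t)) ->
  (forall t (B : bag), P t -> (forall u, u \in B -> P u) -> P (rapp t B)) ->
  (forall b t, P t -> P (rmu b t)) ->
  forall t, P t.
Proof.
move=> hV hL hA hM [t tP]; elim/praw_ind': t tP => [i|t IH|t vs IH IHs|b t IH] tP.
- by have -> : RTerm tP = rvar i by apply: val_inj.
- have -> : RTerm tP = rlam (@RTerm t tP) by apply: val_inj.
  exact/hL/IH.
- have /and3P[tP' vsP vs_s] := tP.
  pose ws : seq rterm := pmap insub vs.
  have ews : [seq rval u | u <- ws] = vs.
    rewrite pmap_filter; last exact: insubK.
    by apply/all_filterP/allP => v /(allP vsP) vP; rewrite /= insubT.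
  have -> : RTerm tP = rapp (RTerm tP') (seq_mset ws).
    apply: val_inj => /=; congr PApp.
    have e : perm_eq [seq rval u | u <- seq_mset ws] vs.
      by rewrite -ews; apply/perm_map/perm_eq_seq_mset.
    apply: (sorted_eq praw_le_trans praw_le_anti vs_s).
      exact/sort_sorted/praw_le_total.
    by rewrite perm_sym perm_sort.
  apply: hA => // u; rewrite (perm_mem (perm_eq_seq_mset ws)) => /(map_f rval).
  rewrite ews => {ws ews tP vs_s}; elim: vs IHs vsP => //= v vs IHvs [Pv Pvs].
  case/andP=> vP vsP; rewrite inE => /orP[/eqP euv|]; last exact: IHvs.
  by rewrite (_ : u = RTerm vP); [apply: Pv | apply: val_inj].
- have -> : RTerm tP = rmu b (@RTerm t tP) by apply: val_inj.
  exact/hM/IH.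
Qed.

Definition map_bag (f : rterm -> rterm) (B : bag) : bag :=
  seq_mset [seq f u | u <- B].

(** Renaming the free variables of a resource term by [f], its names by [g]. *)

Definition up (f : nat -> nat) (i : nat) : nat :=
  if i is j.+1 then (f j).+1 else 0.

Fixpoint ren_praw (f g : nat -> nat) (t : praw) : rterm :=
  match t with
  | PVar i => rvar (f i)
  | PLam t => rlam (ren_praw (up f) g t)
  | PApp t vs => rapp (ren_praw f g t) (seq_mset [seq ren_praw f g v | v <- vs])
  | PMu b t => rmu (up g b) (ren_praw f (up g) t)
  end.

Definition ren (f g : nat -> nat) (t : rterm) : rterm := ren_praw f g t.

Lemma ren_rapp (f g : nat -> nat) (t : rterm) (B : bag) :
  ren f g (rapp t B) = rapp (ren f g t) (map_bag (ren f g) B).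
Proof.
rewrite /ren /=; congr rapp; apply/eq_seq_msetP.
rewrite [X in perm_eq _ X](_ : _ = map (ren_praw f g) (map rval B)).
  by apply: perm_map; rewrite perm_sort.
by rewrite -map_comp.
Qed.

Definition vshift (B : bag) : bag := map_bag (ren S id) B.
Definition nshift (B : bag) : bag := map_bag (ren id S) B.

(** [lsubst k B t] is the sum t<B/k>, as the set of its addends: each rule gives
    the addends of one defining equation, and no rule applies where the
    equation says 0. Variable [k] leaves the scope, hence [unbump k i]. *)

Inductive lsubst : nat -> bag -> rterm -> set rterm :=
| lsubst_var_eq k v :
    lsubst k [mset v] (rvar k) v
| lsubst_var_neq k i : i <> k ->
    lsubst k mset0 (rvar i) (rvar (unbump k i))
| lsubst_lam k B t u :
    lsubst k.+1 (vshift B) t u -> lsubst k B (rlam t) (rlam u)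
| lsubst_mu k B b t u :
    lsubst k (nshift B) t u -> lsubst k B (rmu b t) (rmu b u)
| lsubst_app k n (B0 : bag) (B_ : 'I_n -> bag) t u (v_ w_ : 'I_n -> rterm) :
    lsubst k B0 t u -> (forall i, lsubst k (B_ i) (v_ i) (w_ i)) ->
    lsubst k (B0 `+` \big[msetD/mset0]_(i < n) B_ i)%mset
      (rapp t (seq_mset (codom v_))) (rapp u (seq_mset (codom w_))).

(** [napp a B t] is the sum <t>_a B, and [napp_named a B b t] the sum
    <b|t|>_a B, whose addends c|u| are the pairs [(c, u)]. *)

Inductive napp : nat -> bag -> rterm -> set rterm :=
| napp_var a i :
    napp a mset0 (rvar i) (rvar i)
| napp_lam a B t u :
    napp a (vshift B) t u -> napp a B (rlam t) (rlam u)
| napp_mu a B b t c u :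
    napp_named a.+1 (nshift B) b t (c, u) -> napp a B (rmu b t) (rmu c u)
| napp_app a n (B0 : bag) (B_ : 'I_n -> bag) t u (v_ w_ : 'I_n -> rterm) :
    napp a B0 t u -> (forall i, napp a (B_ i) (v_ i) (w_ i)) ->
    napp a (B0 `+` \big[msetD/mset0]_(i < n) B_ i)%mset
      (rapp t (seq_mset (codom v_))) (rapp u (seq_mset (codom w_)))
with napp_named : nat -> bag -> nat -> rterm -> set (nat * rterm) :=
| napp_named_neq a B b t u : b <> a ->
    napp a B t u -> napp_named a B b t (b, u)
| napp_named_eq a (B1 B2 : bag) t u :
    napp a B1 t u -> napp_named a (B1 `+` B2)%mset a t (a, rapp u B2).

(** The renaming {a/0} that removes the binder of name 0. *)
Definition ninst (a b : nat) : nat := if b is c.+1 then c else a.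

Inductive rred : rterm -> set rterm -> Prop :=
| rred_lam t B :
    rred (rapp (rlam t) B) (lsubst 0 B t)
| rred_mu b t B :
    rred (rapp (rmu b t) B)
      [set rmu cu.1 cu.2 | cu in napp_named 0 (nshift B) b t]
| rred_rho a b t :
    rred (rmu a (rmu b t)) [set rmu (ninst a b) (ren id (ninst a) t)]
| rred_ctx_lam t T : rred t T ->
    rred (rlam t) [set rlam u | u in T]
| rred_ctx_appl t T B : rred t T ->
    rred (rapp t B) [set rapp u B | u in T]
| rred_ctx_appr t v V B : rred v V ->
    rred (rapp t (v +` B)%mset) [set rapp t (w +` B)%mset | w in V]
| rred_ctx_mu b t T : rred t T ->
    rred (rmu b t) [set rmu b u | u in T].

Definition sred (X Y : set rterm) : Prop :=
  exists t T S, [/\ finite_set S, ~ S t, rred t T,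
                    X = t |` S & Y = T `|` S].

Definition sreds : set rterm -> set rterm -> Prop := clos_refl_trans _ sred.

Definition is_nf (t : rterm) (S : set rterm) : Prop :=
  sreds [set t] S /\ forall S', ~ sred S S'.

(** By strong normalisation and confluence exactly one [S] satisfies
    [is_nf t S], so this union is that [S]. *)
Definition nf_r (t : rterm) : set rterm :=
  \bigcup_(S in is_nf t) S.

Fixpoint taylor (M : lterm) : set rterm :=
  match M with
  | Var i => [set rvar i]
  | Lam M => [set rlam t | t in taylor M]
  | App M N => [set rapp t B | t in taylor M &
                               B in [set B : bag | [set` B] `<=` taylor N]]
  | Mu b M => [set rmu b t | t in taylor M]
  end.

Definition NF (X : set rterm) : set rterm := \bigcup_(t in X) nf_r t.

Definition taylor_eq (M N : lterm) : Prop := NF (taylor M) = NF (taylor N).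

(* Main.v *)
Require Import Defs.
From mathcomp Require Import all_boot finmap multiset.
From mathcomp Require Import boolp classical_sets cardinality zify.
From Stdlib Require Import Relation_Operators.

(** The normal form of a resource term is the set of normal terms that end its
    reduction paths. Steps that do not contract the head redex can be postponed
    after the head step, since linear substitution and linear named application
    commute with reduction; hence [NF (taylor M)] is invariant under weak head
    reduction of [M], and if it is not empty then [M] has a weak head normal
    form, because resource reduction terminates.

    Let [F] be constant on the [n] lines. We show that an element [u] of
    [NF (taylor F[Z_1..Z_n])] does not depend on the [Z_j], by induction on [u].
    As [u] exists, [F] reduces to a weak head normal form, before any [Z_j] is
    substituted. Its head variable is not one of the [z_i]: otherwise the term
    would not be constant on the [i]-th line, as one sees by taking for [Z] two
    different constant functions. So the head survives substitution, normal forms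
    are computed argument by argument, the arguments are again constant on the
    lines, and [u] splits into smaller terms. *)

Set Implicit Arguments.
Unset Strict Implicit.
Unset Printing Implicit Defensive.

Local Open Scope mset_scope.
Local Open Scope classical_set_scope.
Local Open Scope nat_scope.

(** * Bags *)

(** Sums are never manipulated as wholes: since + is idempotent, the relation [step] between a term
    and one addend of its contractum suffices. All elements of [taylor M] share the shape of [M], so
    one head redex of [M] is a head redex in each of them, whatever their bags contain; where its
    contraction is 0, the element merely contributes nothing. The obstacle is the rule that merges
    two [mu]s. It identifies two names, so that an argument sent to the merged name reaches subterms
    that were named by either of them. Commuting this rule with named application can cost one more
    reduction, which is why postponement produces [steps] and not a single step. The same rule
    forces head reduction to look below a [mu] at the root. Termination is needed for two purposes:
    to stop head reduction, and to complete a path towards one normal addend into a reduction of the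
    whole sum. The two constant functions put for a head variable z_i swallow exactly as many
    arguments as z_i has there, and then return closed terms with different normal forms,
    [Lam (Var 0)] and [Lam (Lam (Var 0))]. The term around the head cannot hide this difference. *)

Section Bags.
Variable K : choiceType.
Implicit Types (A B C D : {mset K}) (u v w : K).

Lemma mset_nil : seq_mset [::] = mset0 :> {mset K}.
Proof. by apply/msetP => a; rewrite mset_seqE mset0E. Qed.

Lemma mset_elim (P : {mset K} -> Prop) :
  P mset0 -> (forall v C, P C -> P (v +` C)%mset) -> forall C, P C.
Proof.
move=> P0 PS C; rewrite -[C]seq_mset_id.
by elim: (C : seq K) => [|v s IH]; rewrite ?mset_nil // mset_cons; apply: PS.
Qed.

Lemma mset_cat (s t : seq K) : seq_mset (s ++ t) = (seq_mset s `+` seq_mset t)%mset.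
Proof. by apply/msetP => a; rewrite msetE2 !mset_seqE count_cat. Qed.

Lemma msetD_cancel A B C : (A `+` B = A `+` C)%mset -> B = C.
Proof. by move/(congr1 (fun X => X `\` A)%mset); rewrite !msetDKB. Qed.

Lemma cons_mset_neq0 v C : (v +` C)%mset <> mset0.
Proof. by move/msetP/(_ v); rewrite mset1DE eqxx mset0E. Qed.

Lemma msetD_eq0 A B : (A `+` B)%mset = mset0 -> A = mset0 /\ B = mset0.
Proof.
move=> /msetP e; split; apply/msetP => a; have := e a; rewrite msetE2 !mset0E;
  by move/eqP; rewrite addn_eq0 => /andP[/eqP ? /eqP ?].
Qed.

Lemma mset_mem_cons v C : v \in C -> exists D, C = (v +` D)%mset.
Proof. by move=> vC; exists (C `\ v)%mset; rewrite msetB1K. Qed.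

Lemma cons_mset_eq v w C D : (v +` C = w +` D)%mset ->
  (v = w /\ C = D) \/ exists E, C = (w +` E)%mset /\ D = (v +` E)%mset.
Proof.
move=> e; case: (eqVneq v w) => [vw|nvw].
  by left; split=> //; move: e; rewrite vw => /msetD_cancel.
have : v \in (w +` D)%mset by rewrite -e mset1D1.
rewrite in_mset1D (negPf nvw) => /mset_mem_cons[E eD]; right; exists E; split=> //.
by apply: (@msetD_cancel [mset v]%mset); rewrite e eD msetDCA.
Qed.

Lemma msetD_eq_cons A B v C : (A `+` B = v +` C)%mset ->
  (exists A', A = (v +` A')%mset /\ C = (A' `+` B)%mset) \/
  (exists B', B = (v +` B')%mset /\ C = (A `+` B')%mset).
Proof.
move=> e; have : v \in (A `+` B)%mset by rewrite e mset1D1.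
rewrite in_msetD => /orP[] /mset_mem_cons[D eD]; [left|right]; exists D; split=> //;
  apply: (@msetD_cancel [mset v]%mset); rewrite -e eD; first by rewrite msetDA.
by rewrite msetDCA.
Qed.

Lemma mset1_eq_cons u v C : [mset u]%mset = (v +` C)%mset -> u = v /\ C = mset0.
Proof.
rewrite -[[mset u]%mset]msetD0 => /cons_mset_eq[[-> <-] //|[E [e _]]].
by case: (@cons_mset_neq0 v E).
Qed.

End Bags.

Lemma map_bag0 f : map_bag f mset0 = mset0.
Proof. by rewrite /map_bag enum_mset0 mset_nil. Qed.

Lemma map_bag_seq f s : map_bag f (seq_mset s) = seq_mset (map f s).
Proof. by apply/eq_seq_msetP/perm_map/perm_eq_seq_mset. Qed.

Lemma map_bagD f (B C : bag) : map_bag f (B `+` C)%mset = (map_bag f B `+` map_bag f C)%mset.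
Proof.
rewrite -{1}[B]seq_mset_id -{1}[C]seq_mset_id -mset_cat map_bag_seq map_cat.
by rewrite mset_cat.
Qed.

Lemma map_bag1 f v : map_bag f [mset v]%mset = [mset f v]%mset.
Proof. by rewrite /map_bag enum_msetn /= mset_cons mset_nil msetD0. Qed.

Lemma map_bagS f v (B : bag) : map_bag f (v +` B)%mset = (f v +` map_bag f B)%mset.
Proof. by rewrite map_bagD map_bag1. Qed.

Lemma map_bag_comp f g (B : bag) : map_bag f (map_bag g B) = map_bag (f \o g) B.
Proof. by rewrite {2}/map_bag map_bag_seq -map_comp. Qed.

Lemma eq_in_map_bag f g (B : bag) :
  (forall u, u \in B -> f u = g u) -> map_bag f B = map_bag g B.
Proof. by move=> e; rewrite /map_bag; congr seq_mset; apply/eq_in_map. Qed.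

Lemma mem_map_bag f (B : bag) u :
  u \in map_bag f B -> exists2 v, v \in B & u = f v.
Proof. by rewrite (perm_mem (perm_eq_seq_mset _)) => /mapP. Qed.

Lemma map_bag_f f (B : bag) u : u \in B -> f u \in map_bag f B.
Proof. by move=> uB; rewrite (perm_mem (perm_eq_seq_mset _)) map_f. Qed.

Lemma map_bag_eq0 f (B : bag) : map_bag f B = mset0 -> B = mset0.
Proof. by case: (mset_0Vmem B) => // -[u /(map_bag_f f)] h e; move: h; rewrite e in_mset0. Qed.

Lemma map_bag_eq_cons f (B : bag) v C : map_bag f B = (v +` C)%mset ->
  exists u D, [/\ B = (u +` D)%mset, v = f u & C = map_bag f D].
Proof.
move=> e; have : v \in map_bag f B by rewrite e mset1D1.
case/mem_map_bag => u /mset_mem_cons[D eB] ev; exists u, D; split=> //.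
by apply: (@msetD_cancel _ [mset v]%mset); rewrite -e eB map_bagS ev.
Qed.

Lemma map_bag_eq1 f (B : bag) v : map_bag f B = [mset v]%mset ->
  exists2 u, B = [mset u]%mset & v = f u.
Proof.
rewrite -[[mset v]%mset]msetD0 => /map_bag_eq_cons[u [D [-> -> /esym/map_bag_eq0 ->]]].
by exists u; rewrite ?msetD0.
Qed.

Lemma map_bag_eqD f (B C D : bag) : map_bag f B = (C `+` D)%mset ->
  exists B1 B2, [/\ B = (B1 `+` B2)%mset, C = map_bag f B1 & D = map_bag f B2].
Proof.
elim/mset_elim: C B => [|v C IH] B.
  by rewrite mset0D => <-; exists mset0, B; rewrite mset0D map_bag0.
rewrite -msetDA => /map_bag_eq_cons[u [E [-> ->]]] /esym/IH[B1 [B2 [-> -> ->]]].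
by exists (u +` B1)%mset, B2; rewrite msetDA map_bagS.
Qed.

(** [bmap R B C D]: the bag [B] is distributed over the elements of [C], and [R]
    carries them one by one to those of [D]. *)
Inductive bmap (R : bag -> rterm -> rterm -> Prop) : bag -> bag -> bag -> Prop :=
| bmap0 : bmap R mset0 mset0 mset0
| bmapS B1 B2 v w C D : R B1 v w -> bmap R B2 C D ->
    bmap R (B1 `+` B2)%mset (v +` C)%mset (w +` D)%mset.

Section BMap.
Implicit Type R : bag -> rterm -> rterm -> Prop.

Lemma bmap_nilP R B E : bmap R B mset0 E -> B = mset0 /\ E = mset0.
Proof.
suff aux C : bmap R B C E -> C = mset0 -> B = mset0 /\ E = mset0 by move/aux; apply.
by case=> // B1 B2 v w C' D _ _ /cons_mset_neq0.
Qed.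

(** A derivation may treat [v] last; the induction brings it to the front, which is allowed because
    the shares of a weak composition are joined by a commutative union. *)
Lemma bmap_consP R B v C E : bmap R B (v +` C)%mset E ->
  exists B1 B2 w D, [/\ B = (B1 `+` B2)%mset, E = (w +` D)%mset, R B1 v w & bmap R B2 C D].
Proof.
move=> h; have [C' eC] : exists C', C' = (v +` C)%mset by eexists.
rewrite -eC in h; elim: h C eC => [C /esym/cons_mset_neq0 //|B1 B2 v0 w0 C0 D0 h0 hs IH C].
case/cons_mset_eq => [[<- <-]|[G [eG ->]]]; first by exists B1, B2, w0, D0.
have [B3 [B4 [w [D [-> -> hw hD]]]]] := IH _ eG.
exists B3, (B1 `+` B4)%mset, w, (w0 +` D)%mset; split=> //.
- by rewrite msetDCA.
- by rewrite msetDCA.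
- exact: bmapS.
Qed.

Lemma bmap1 R B v w : R B v w -> bmap R B [mset v]%mset [mset w]%mset.
Proof. by move=> h; have := bmapS h (bmap0 R); rewrite !msetD0. Qed.

Lemma bmapD R B1 B2 C1 C2 D1 D2 : bmap R B1 C1 D1 -> bmap R B2 C2 D2 ->
  bmap R (B1 `+` B2)%mset (C1 `+` C2)%mset (D1 `+` D2)%mset.
Proof.
move=> h h2; elim: h => [|B1' B2' v w C' D' hv _ IH]; first by rewrite !mset0D.
by rewrite -!msetDA; apply: bmapS.
Qed.

(** The bridge to the application rules of [lsubst] and [napp], whose weak compositions are indexed
    by ordinals; beyond it bags are treated one element at a time. *)
Lemma bmap_bigP R B C D : bmap R B C D <->
  exists n (B_ : 'I_n -> bag) (v_ w_ : 'I_n -> rterm),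
    [/\ B = (\big[msetD/mset0]_(i < n) B_ i)%mset, C = seq_mset (codom v_),
        D = seq_mset (codom w_) & forall i, R (B_ i) (v_ i) (w_ i)].
Proof.
have codomE n (T : choiceType) (f : 'I_n.+1 -> T) : 
   codom f = f ord0 :: codom (fun i => f (lift ord0 i)).
  by rewrite /codom /image_mem enum_ordSl /= -map_comp.
split=> [|[n [B_ [v_ [w_ [-> -> -> h]]]]]].
  elim=> [|B1 B2 v w C' D' hv _ [n [B_ [v_ [w_ [-> -> -> h]]]]]].
    exists 0, (fun=> mset0), (fun=> rvar 0), (fun=> rvar 0).
    by rewrite big_ord0 /codom /image_mem enum_ord0 mset_nil; split=> // -[].
  pose cns T (x : T) (f : 'I_n -> T) (i : 'I_n.+1) := if unlift ord0 i is Some j then f j else x.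
  have cns0 T x f : @cns T x f ord0 = x by rewrite /cns unlift_none.
  have cnsS T x f j : @cns T x f (lift ord0 j) = f j by rewrite /cns liftK.
  exists n.+1, (cns _ B1 B_), (cns _ v v_), (cns _ w w_); split.
  - by rewrite big_ord_recl cns0; congr msetD; apply: eq_bigr => i _; rewrite cnsS.
  - by rewrite codomE cns0 mset_cons; congr msetD; congr seq_mset; apply: eq_map => i; rewrite cnsS.
  - by rewrite codomE cns0 mset_cons; congr msetD; congr seq_mset; apply: eq_map => i; rewrite cnsS.
  - by move=> i; case: (unliftP ord0 i) => [j|] ->; rewrite ?cns0 ?cnsS.
elim: n B_ v_ w_ h => [|n IH] B_ v_ w_ h.
  by rewrite big_ord0 /codom /image_mem enum_ord0 mset_nil; apply: bmap0.
rewrite big_ord_recl !codomE !mset_cons; apply: bmapS => //.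
by apply: IH => i; apply: h.
Qed.

End BMap.

(** * Renaming *)

Lemma up_id : up id =1 id. Proof. by case. Qed.
Lemma up_comp f g : up f \o up g =1 up (f \o g). Proof. by case. Qed.
Lemma eq_up f g : f =1 g -> up f =1 up g. Proof. by move=> e [|i] //=; rewrite e. Qed.

Lemma ren_rvar f g i : ren f g (rvar i) = rvar (f i). Proof. by []. Qed.
Lemma ren_rlam f g t : ren f g (rlam t) = rlam (ren (up f) g t). Proof. by []. Qed.
Lemma ren_rmu f g b t : ren f g (rmu b t) = rmu (up g b) (ren f (up g) t). Proof. by []. Qed.
Definition renE := (ren_rvar, ren_rlam, ren_rmu, ren_rapp).

Lemma eq_ren f f' g g' : f =1 f' -> g =1 g' -> ren f g =1 ren f' g'.
Proof.
move=> ef eg t; elim/rterm_ind': t f f' g g' ef eg => [i|t IH|t B IH IHB|b t IH] f f' g g' ef eg.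
- by rewrite !renE ef.
- by rewrite !renE (IH _ _ _ _ (eq_up ef) eg).
- rewrite !renE (IH _ _ _ _ ef eg); congr rapp.
  by apply: eq_in_map_bag => u uB; apply: IHB.
- by rewrite !renE (eq_up eg) (IH _ _ _ _ ef (eq_up eg)).
Qed.

Lemma ren_comp f f' g g' t : ren f g (ren f' g' t) = ren (f \o f') (g \o g') t.
Proof.
elim/rterm_ind': t f f' g g' => [i|t IH|t B IH IHB|b t IH] f f' g g'; rewrite !renE.
- by [].
- by rewrite IH (eq_ren (up_comp _ _) (frefl _)).
- rewrite IH; congr rapp; rewrite map_bag_comp.
  by apply: eq_in_map_bag => u uB; apply: IHB.
- by rewrite IH (eq_ren (frefl _) (up_comp _ _)) -up_comp.
Qed.

Lemma ren_id t : ren id id t = t.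
Proof.
elim/rterm_ind': t => [i|t IH|t B IH IHB|b t IH]; rewrite !renE.
- by [].
- by rewrite (eq_ren up_id (frefl _)) IH.
- rewrite IH; congr rapp; rewrite -[RHS]seq_mset_id; congr seq_mset.
  by rewrite -[RHS]map_id; apply/eq_in_map => u uB; apply: IHB.
- by rewrite (eq_ren (frefl _) up_id) IH up_id.
Qed.

Lemma map_bag_ren f f' g g' B :
  map_bag (ren f g) (map_bag (ren f' g') B) = map_bag (ren (f \o f') (g \o g')) B.
Proof. by rewrite map_bag_comp; apply: eq_in_map_bag => u _; apply: ren_comp. Qed.

Lemma map_bag_ren_id B : map_bag (ren id id) B = B.
Proof.
rewrite -[RHS]seq_mset_id; congr seq_mset.
by rewrite -[RHS]map_id; apply: eq_map => u; apply: ren_id.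
Qed.

Lemma vshift_ren f g B : vshift (map_bag (ren f g) B) = map_bag (ren (S \o f) g) B.
Proof. exact: map_bag_ren. Qed.
Lemma nshift_ren f g B : nshift (map_bag (ren f g) B) = map_bag (ren f (S \o g)) B.
Proof. exact: map_bag_ren. Qed.
Lemma ren_vshift f g B : map_bag (ren (up f) g) (vshift B) = vshift (map_bag (ren f g) B).
Proof. by rewrite vshift_ren map_bag_ren. Qed.
Lemma ren_nshift f g B : map_bag (ren f (up g)) (nshift B) = nshift (map_bag (ren f g) B).
Proof. by rewrite nshift_ren map_bag_ren. Qed.

(** * Linear substitution and linear named application *)

(** [KV k] stands for the linear substitution of variable [k], [KN a] for the
    linear named application at name [a]: outside the leaves and the named
    subterms the two operations obey the same equations. *)
Inductive kind := KV of nat | KN of nat.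
Definition upv K := if K is KV k then KV k.+1 else K.
Definition upn K := if K is KN a then KN a.+1 else K.

Definition gsub K B t u :=
  match K with KV k => lsubst k B t u | KN a => napp a B t u end.

(** The outer name never changes, so the pair of [napp_named] is reduced to its second component.
    For a kind [KV] only the first alternative can hold. *)
Definition gnamed K B b t u :=
  (K <> KN b /\ gsub K B t u) \/
  (K = KN b /\ exists B1 B2 u1, [/\ B = (B1 `+` B2)%mset, gsub K B1 t u1 & u = rapp u1 B2]).

Lemma napp_namedE a B b t c u : napp_named a B b t (c, u) <-> c = b /\ gnamed (KN a) B b t u.
Proof.
split=> [h|[-> [[nab h]|[[->] [B1 [B2 [u1 [-> h ->]]]]]]]].
- have [cu ecu] : exists cu, cu = (c, u) by eexists.
  rewrite -ecu in h; case: h ecu => [a' B' b' t' u' nba h [<- <-]|a' B1 B2 t' u' h [<- <-]].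
    by split=> //; left; split=> // -[]/esym.
  by split=> //; right; split=> //; exists B1, B2, u'.
- by apply: napp_named_neq => // e; apply: nab; rewrite e.
- exact: napp_named_eq.
Qed.

Definition gsub_spec K B t u : Prop :=
  [\/ exists2 i, t = rvar i &
        match K with
        | KV k => (i = k /\ B = [mset u]%mset) \/ [/\ i <> k, B = mset0 & u = rvar (unbump k i)]
        | KN _ => B = mset0 /\ u = rvar i
        end,
      exists t' u', [/\ t = rlam t', u = rlam u' & gsub (upv K) (vshift B) t' u'],
      exists b t' u', [/\ t = rmu b t', u = rmu b u' & gnamed (upn K) (nshift B) b t' u'] |
      exists B0 B1 t' u' C D, [/\ t = rapp t' C, u = rapp u' D, B = (B0 `+` B1)%mset,
        gsub K B0 t' u' & bmap (gsub K) B1 C D]].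

Lemma gsubP K B t u : gsub K B t u <-> gsub_spec K B t u.
Proof.
split.
  case: K => [k|a] /= h.
  - case: {k B t u} h => [k v|k i nik|k B t u h|k B b t u h|k n B0 B_ t u v_ w_ h hs].
    + by apply: Or41; exists k => //; left.
    + by apply: Or41; exists i => //; right.
    + by apply: Or42; exists t, u.
    + by apply: Or43; exists b, t, u; split=> //; left.
    + apply: Or44; do 6 eexists; split; [by []|by []|by []|exact: h|].
      by apply/bmap_bigP; exists n, B_, v_, w_.
  - case: {a B t u} h => [a i|a B t u h|a B b t c u h|a n B0 B_ t u v_ w_ h hs].
    + by apply: Or41; exists i.
    + by apply: Or42; exists t, u.
    + by move/napp_namedE: h => [-> h]; apply: Or43; exists b, t, u.
    + apply: Or44; do 6 eexists; split; [by []|by []|by []|exact: h|].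
      by apply/bmap_bigP; exists n, B_, v_, w_.
case=> [[i ->]|[t' [u' [-> ->]]]|[b [t' [u' [-> -> h]]]]|[B0 [B1 [t' [u' [C [D [-> -> -> h0]]]]]]]].
- case: K => [k [[-> ->]|[nik -> ->]]|a [-> ->]] /=.
  + exact: lsubst_var_eq.
  + exact: lsubst_var_neq.
  + exact: napp_var.
- by case: K => [k|a] /= h; [apply: lsubst_lam|apply: napp_lam].
- case: K h => [k [[_ h]|[]//]|a h]; first exact: lsubst_mu.
  by apply: napp_mu; apply/napp_namedE.
- case/bmap_bigP => n [B_ [v_ [w_ [-> -> -> hs]]]].
  by case: K h0 hs => [k|a] /= h0 hs; [apply: lsubst_app|apply: napp_app].
Qed.

Ltac rdiscr := let e := fresh in move=> /(congr1 rval) e; discriminate e.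

Lemma gsub_rvar K B i u : gsub K B (rvar i) u <->
  match K with
  | KV k => (i = k /\ B = [mset u]%mset) \/ [/\ i <> k, B = mset0 & u = rvar (unbump k i)]
  | KN _ => B = mset0 /\ u = rvar i
  end.
Proof.
split=> [/gsubP[[j /rvar_inj <-] //|[? [? []]]|[? [? [? []]]]|[? [? [? [? [? [? []]]]]]]]|h].
1-3: by rdiscr.
by apply/gsubP/Or41; exists i.
Qed.

Lemma gsub_rlam K B t u : gsub K B (rlam t) u <->
  exists2 u', gsub (upv K) (vshift B) t u' & u = rlam u'.
Proof.
split=> [/gsubP[[? ]|[? [u' [/rlam_inj <- -> h]]]|[? [? [? []]]]|[? [? [? [? [? [? []]]]]]]]|[u' h ->]].
1,3,4: by rdiscr.
- by exists u'.
- by apply/gsubP/Or42; exists t, u'.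
Qed.

Lemma gsub_rmu K B b t u : gsub K B (rmu b t) u <->
  exists2 u', gnamed (upn K) (nshift B) b t u' & u = rmu b u'.
Proof.
split=> [/gsubP[[? ]|[? [? []]]|[? [? [u' [/rmu_inj[<- <-] -> h]]]]|[? [? [? [? [? [? []]]]]]]]|[u' h ->]].
1,2,4: by rdiscr.
- by exists u'.
- by apply/gsubP/Or43; exists b, t, u'.
Qed.

Lemma gsub_rapp K B t C u : gsub K B (rapp t C) u <->
  exists B0 B1 t' D, [/\ B = (B0 `+` B1)%mset, gsub K B0 t t', bmap (gsub K) B1 C D & u = rapp t' D].
Proof.
split=> [/gsubP[[? ]|[? [? []]]|[? [? [? []]]]|
                [B0 [B1 [? [t' [? [D [/rapp_inj[<- <-] -> -> h0 h1]]]]]]]]|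
         [B0 [B1 [t' [D [-> h0 h1 ->]]]]]].
1-3: by rdiscr.
- by exists B0, B1, t', D.
- by apply/gsubP/Or44; exists B0, B1, t, t', C, D.
Qed.

Lemma gnamed_mono K K' B B' b b' t t' u u' :
  (K = KN b <-> K' = KN b') -> (K <> KN b -> gsub K B t u -> gsub K' B' t' u') ->
  (K = KN b -> forall B1 B2 u1, B = (B1 `+` B2)%mset -> gsub K B1 t u1 -> u = rapp u1 B2 ->
     exists B1' B2' u1', [/\ B' = (B1' `+` B2')%mset, gsub K' B1' t' u1' & u' = rapp u1' B2']) ->
  gnamed K B b t u -> gnamed K' B' b' t' u'.
Proof.
move=> eK h1 h2 [[nK h]|[e [B1 [B2 [u1 [eB h eu]]]]]].
  by left; split; [rewrite -eK | exact: h1].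
by right; split; [rewrite -eK | exact: h2 eB h eu].
Qed.

(** Removing the object [K] turns the renaming [f'] into [f]. *)
Definition rencompat K K' (f' f g : nat -> nat) : Prop :=
  match K, K' with
  | KV k, KV k' => f' k = k' /\ forall i, i <> k -> f' i <> k' /\ unbump k' (f' i) = f (unbump k i)
  | KN a, KN a' => f' =1 f /\ a' = g a /\ forall b, g b = g a -> b = a
  | _, _ => False
  end.

Lemma unbumpSS k i : unbump k.+1 i.+1 = if i == k then k.+1 else (unbump k i).+1.
Proof. by rewrite /unbump; case: eqP => [->|]; case: (ltnP k i); lia. Qed.

Lemma rencompat_upv K K' f' f g :
  rencompat K K' f' f g -> rencompat (upv K) (upv K') (up f') (up f) g.
Proof.
case: K K' => [k|a] [k'|a'] //= [e h]; last by split=> //; apply: eq_up.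
split=> [|[|i] ni] /=; first by rewrite e.
  by split.
have [n1 n2] := h i (fun e => ni (congr1 S e)); split=> [[]//|].
rewrite !unbumpSS; case: eqP => // _; case: eqP => [e'|_]; first by case: ni; rewrite e'.
by rewrite n2.
Qed.

Lemma rencompat_upn K K' f' f g :
  rencompat K K' f' f g -> rencompat (upn K) (upn K') f' f (up g).
Proof.
case: K K' => [k|a] [k'|a'] //= [e [-> h]]; split=> //; split=> // -[|b] //= [] /h ->.
by [].
Qed.

Lemma rencompatN K K' f' f g b : rencompat K K' f' f g -> K = KN b <-> K' = KN (g b).
Proof.
case: K K' => [k|a] [k'|a'] //= [_ [-> h]]; split=> [[->]//|[]/esym/h ->//].
Qed.

Lemma bmap_map (R R' : bag -> rterm -> rterm -> Prop) p q r B C D :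
  (forall v, v \in C -> forall B w, R B v w -> R' (map_bag p B) (q v) (r w)) ->
  bmap R B C D -> bmap R' (map_bag p B) (map_bag q C) (map_bag r D).
Proof.
move=> h hb; elim: hb h => [|B1 B2 v w C' D' hv _ IH] h; first by rewrite !map_bag0; apply: bmap0.
rewrite map_bagD !map_bagS; apply: bmapS; first by apply: h hv; rewrite mset1D1.
by apply: IH => x xC; apply: h; rewrite mset1Dr.
Qed.

Lemma bmap_map_inv (R R' : bag -> rterm -> rterm -> Prop) p q r B C D' :
  (forall v, v \in C -> forall B w', R' (map_bag p B) (q v) w' -> exists2 w, w' = r w & R B v w) ->
  bmap R' (map_bag p B) (map_bag q C) D' -> exists2 D, D' = map_bag r D & bmap R B C D.
Proof.
elim/mset_elim: C B D' => [|v C IH] B D' h.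
  by rewrite map_bag0 => /bmap_nilP[/map_bag_eq0-> ->]; exists mset0; rewrite ?map_bag0 //; apply: bmap0.
rewrite map_bagS => /bmap_consP[B1 [B2 [w' [D2]]]].
move=> [/map_bag_eqD[B3 [B4 [-> -> ->]]] -> /h[|w -> hw]]; first by rewrite mset1D1.
move=> /IH[x xC|D -> hD]; first by apply: h; rewrite mset1Dr.
by exists (w +` D)%mset; rewrite ?map_bagS //; apply: bmapS.
Qed.

Lemma gnamed_ren_of K K' f' f g t :
  rencompat K K' f' f g ->
  (forall B u, gsub K B t u -> gsub K' (map_bag (ren f g) B) (ren f' g t) (ren f g u)) ->
  forall B b u, gnamed K B b t u ->
    gnamed K' (map_bag (ren f g) B) (g b) (ren f' g t) (ren f g u).
Proof.
move=> c IH B b u; apply: gnamed_mono => [|_|_ B1 B2 u1 -> /IH h ->]; first exact: rencompatN c.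
  exact: IH.
by exists (map_bag (ren f g) B1), (map_bag (ren f g) B2), (ren f g u1); rewrite map_bagD renE.
Qed.

Lemma gsub_ren K K' f' f g B t u : rencompat K K' f' f g ->
  gsub K B t u -> gsub K' (map_bag (ren f g) B) (ren f' g t) (ren f g u).
Proof.
elim/rterm_ind': t K K' f' f g B u => [i|t IH|t C IH IHC|b t IH] K K' f' f g B u c.
- rewrite renE !gsub_rvar; case: K K' c => [k|a] [k'|a'] //= [e h].
    case=> [[-> ->]|[ni -> ->]]; first by left; rewrite map_bag1.
    by right; have [n1 n2] := h _ ni; rewrite map_bag0 renE n2.
  by case=> -> ->; rewrite map_bag0 renE e.
- rewrite renE !gsub_rlam => -[u' h ->]; exists (ren (up f) g u'); rewrite ?renE //.
  by rewrite -ren_vshift; apply: IH h; apply: rencompat_upv.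
- rewrite renE !gsub_rapp => -[B0 [B1 [t' [D [-> h0 h1 ->]]]]].
  exists (map_bag (ren f g) B0), (map_bag (ren f g) B1), (ren f g t'), (map_bag (ren f g) D).
  rewrite map_bagD renE; split=> //; first exact: IH h0.
  by apply: bmap_map h1 => v vC B' w; apply: IHC.
- rewrite renE !gsub_rmu => -[u' h ->]; exists (ren f (up g) u'); rewrite ?renE //.
  rewrite -ren_nshift; have c' := rencompat_upn c.
  by apply: (gnamed_ren_of c') h => B' u''; apply: IH.
Qed.

Lemma gnamed_ren K K' f' f g B b t u : rencompat K K' f' f g ->
  gnamed K B b t u -> gnamed K' (map_bag (ren f g) B) (g b) (ren f' g t) (ren f g u).
Proof. by move=> c; apply: gnamed_ren_of => // B' u'; apply: gsub_ren. Qed.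

Lemma gnamed_ren_inv_of K K' f' f g t :
  rencompat K K' f' f g ->
  (forall B u', gsub K' (map_bag (ren f g) B) (ren f' g t) u' ->
     exists2 u, u' = ren f g u & gsub K B t u) ->
  forall B b u', gnamed K' (map_bag (ren f g) B) (g b) (ren f' g t) u' ->
     exists2 u, u' = ren f g u & gnamed K B b t u.
Proof.
move=> c IH B b u [[nK /IH[u' -> h]]|[eK [B1 [B2 [u1 [/map_bag_eqD[B3 [B4 [-> -> ->]]]]]]]]].
  by exists u' => //; left; split=> //; rewrite (rencompatN _ c).
move=> /IH[u2 -> h] ->; exists (rapp u2 B4); first by rewrite renE.
by right; split; [rewrite (rencompatN _ c)|exists B3, B4, u2].
Qed.

(** A compatible renaming changes neither the shape of [t] nor the leaves and names that are hit, so
    results on renamed data are themselves renamed. This serves to undo shifts and harmless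
    merges. *)
Lemma gsub_ren_inv K K' f' f g B t u' : rencompat K K' f' f g ->
  gsub K' (map_bag (ren f g) B) (ren f' g t) u' -> exists2 u, u' = ren f g u & gsub K B t u.
Proof.
elim/rterm_ind': t K K' f' f g B u' => [i|t IH|t C IH IHC|b t IH] K K' f' f g B u' c.
- rewrite renE gsub_rvar; case: K K' c => [k|a] [k'|a'] //= [e h].
    have [->|/eqP ni] := eqVneq i k.
      case=> [[_ /map_bag_eq1[u -> ->]]|[]]; last by rewrite e.
      by exists u => //; apply/(gsub_rvar (KV k)); left.
    have [n1 n2] := h _ ni.
    case=> [[]//|[_ /map_bag_eq0 -> ->]]; exists (rvar (unbump k i)); first by rewrite renE n2.
    by apply/(gsub_rvar (KV k)); right.
  case=> /map_bag_eq0 -> ->; exists (rvar i); first by rewrite renE e.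
  by apply/(gsub_rvar (KN a)).
- rewrite renE gsub_rlam -ren_vshift => -[u1 /(IH _ _ _ _ _ _ _ (rencompat_upv c))[u -> h] ->].
  by exists (rlam u); rewrite ?renE // gsub_rlam; exists u.
- rewrite renE gsub_rapp => -[B0 [B1 [t' [D [/map_bag_eqD[B2 [B3 [-> -> ->]]]]]]]].
  move=> /(IH _ _ _ _ _ _ _ c)[u -> h] /bmap_map_inv H ->.
  have [|D' -> hD] := H (gsub K) (ren f g).
    by move=> v vC B' w' /(IHC _ vC _ _ _ _ _ _ _ c).
  by exists (rapp u D'); rewrite ?renE // gsub_rapp; exists B2, B3, u, D'.
- rewrite renE gsub_rmu -ren_nshift; have c' := rencompat_upn c.
  move=> [u1 /(gnamed_ren_inv_of c' (fun B' u2 => IH _ _ _ _ _ B' u2 c'))[u -> h] ->].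
  by exists (rmu b u); rewrite ?renE // gsub_rmu; exists u.
Qed.

Lemma gnamed_ren_inv K K' f' f g B b t u' : rencompat K K' f' f g ->
  gnamed K' (map_bag (ren f g) B) (g b) (ren f' g t) u' ->
  exists2 u, u' = ren f g u & gnamed K B b t u.
Proof. by move=> c; apply: gnamed_ren_inv_of => // B' u2; apply: gsub_ren_inv. Qed.

(** The object [K] does not occur in terms renamed by [h'] and [g]; removing it
    turns [h'] into [h]. *)
Definition fresh K (h' h g : nat -> nat) : Prop :=
  match K with
  | KV k => forall i, h' i <> k /\ h i = unbump k (h' i)
  | KN a => h' =1 h /\ forall b, g b <> a
  end.

Lemma fresh_upv K h' h g : fresh K h' h g -> fresh (upv K) (up h') (up h) g.
Proof.
case: K => [k|a] /= H; last by case: H => e H; split=> //; apply: eq_up.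
case=> [|i] //=; have [n1 ->] := H i; rewrite unbumpSS; case: eqP => // _; split=> //; lia.
Qed.

Lemma fresh_upn K h' h g : fresh K h' h g -> fresh (upn K) h' h (up g).
Proof. by case: K => [k|a] //= [e H]; split=> // -[|b] //= [] /H. Qed.

Lemma freshS_upv K h' h g : fresh K h' h g -> fresh (upv K) (S \o h') (S \o h) g.
Proof.
case: K => [k|a] /= H; first by move=> i; apply: (fresh_upv (K := KV k) H i.+1).
by case: H => e H; split=> // i /=; rewrite e.
Qed.

Lemma freshS_upn K h' h g : fresh K h' h g -> fresh (upn K) h' h (S \o g).
Proof. by case: K => [k|a] //= [e H]; split=> // b [] /H. Qed.

Lemma bmap_diag (R : bag -> rterm -> rterm -> Prop) p q C :
  (forall v, v \in C -> R mset0 (p v) (q v)) -> bmap R mset0 (map_bag p C) (map_bag q C).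
Proof.
elim/mset_elim: C => [|v C IH] h; first by rewrite !map_bag0; apply: bmap0.
rewrite !map_bagS -[X in bmap R X](msetD0 mset0); apply: bmapS; first by apply: h; rewrite mset1D1.
by apply: IH => x xC; apply: h; rewrite mset1Dr.
Qed.

Lemma gsub_fresh K h' h g t : fresh K h' h g -> gsub K mset0 (ren h' g t) (ren h g t).
Proof.
elim/rterm_ind': t K h' h g => [i|t IH|t C IH IHC|b t IH] K h' h g c; rewrite !renE.
- apply/gsub_rvar; case: K c => [k|a] /= H; last by case: H => e _; rewrite e.
  by right; have [n1 ->] := H i.
- apply/gsub_rlam; exists (ren (up h) g t) => //; rewrite /vshift map_bag0.
  by apply: IH; apply: fresh_upv.
- apply/gsub_rapp; exists mset0, mset0, (ren h g t), (map_bag (ren h g) C).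
  by rewrite msetD0; split=> //; [apply: IH|apply: bmap_diag => v vC; apply: IHC].
- apply/gsub_rmu; exists (ren h (up g) t) => //; rewrite /nshift map_bag0; left; split.
    by move/fresh_upn: c; case: (upn K) => [k|a] //= [_ H] [] e; case: (H b).
  by apply: IH; apply: fresh_upn.
Qed.

Lemma bmap_fresh K h' h g C : fresh K h' h g ->
  bmap (gsub K) mset0 (map_bag (ren h' g) C) (map_bag (ren h g) C).
Proof. by move=> c; apply: bmap_diag => v _; apply: gsub_fresh. Qed.

(** [kcomm K K' Ku]: when the object [K], removed first, is put back, the object
    [K'] is called [Ku]. *)
Definition kcomm K K' Ku : Prop :=
  match K, K' with
  | KV k, KV k' => k <= k' /\ Ku = KV k'.+1
  | KN a, KN c => a <> c /\ Ku = K'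
  | _, _ => Ku = K'
  end.

Lemma kcomm_upv K K' Ku : kcomm K K' Ku -> kcomm (upv K) (upv K') (upv Ku).
Proof. by case: K K' => [k|a] [k'|a'] /= => [[h ->]|->|->|[h ->]]. Qed.

Lemma kcomm_upn K K' Ku : kcomm K K' Ku -> kcomm (upn K) (upn K') (upn Ku).
Proof. by case: K K' => [k|a] [k'|a'] /= => [[h ->]|->|->|[h ->]] //; split=> // -[]. Qed.

Lemma kcommN K K' Ku b : kcomm K K' Ku -> K' = KN b <-> Ku = KN b.
Proof. by case: K K' => [k|a] [k'|a'] /= => [[h ->]|->|->|[h ->]]. Qed.

Lemma kcommNN K K' Ku b : kcomm K K' Ku -> K = KN b -> K' = KN b -> False.
Proof. by case: K K' => [k|a] [k'|a'] //= [n _] [e1] [e2]; apply: n; rewrite e1 e2. Qed.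

(** The substitution lemma on addends: t<D/K><E/K'> is the sum of t<E1/Ku><D<E2/K'>/K> over the
    splittings of [E] into [E1] and [E2]. The object [K] does not occur in [E]; the same raw bag is
    renamed by [h'] while [K] is in scope and by [h] once it is gone. *)
Definition commutes_at t := forall K K' Ku h' h g D E w v,
  kcomm K K' Ku -> fresh K h' h g ->
  gsub K D t w -> gsub K' (map_bag (ren h g) E) w v ->
  exists E1 E2 w' D', [/\ E = (E1 `+` E2)%mset, gsub Ku (map_bag (ren h' g) E1) t w',
    bmap (gsub K') (map_bag (ren h g) E2) D D' & gsub K D' w' v].

Lemma gnamed_comm_of t : commutes_at t -> forall K K' Ku h' h g D E b w v,
  kcomm K K' Ku -> fresh K h' h g ->
  gnamed K D b t w -> gnamed K' (map_bag (ren h g) E) b w v ->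
  exists E1 E2 w' D', [/\ E = (E1 `+` E2)%mset, gnamed Ku (map_bag (ren h' g) E1) b t w',
    bmap (gsub K') (map_bag (ren h g) E2) D D' & gnamed K D' b w' v].
Proof.
move=> IH K K' Ku h' h g D E b w v kc fr [[nK hw]|[eK [D1 [D2 [w1 [-> hw ->]]]]]].
  case=> [[nK' hv]|[eK' [? [? [v1 [/map_bag_eqD[E1 [E2 [-> -> ->]]] hv ->]]]]]].
    have [E1 [E2 [w' [D' [-> h1 h2 h3]]]]] := IH _ _ _ _ _ _ _ _ _ _ kc fr hw hv.
    exists E1, E2, w', D'; split=> //; left; split=> //.
    by rewrite -(kcommN _ kc).
  have [E3 [E4 [w' [D' [-> h1 h2 h3]]]]] := IH _ _ _ _ _ _ _ _ _ _ kc fr hw hv.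
  (* The arguments [E2] are attached at the name before [K] is treated. They do not contain [K], so
     they take an empty share of [D']. *)
  exists (E3 `+` E2)%mset, E4, (rapp w' (map_bag (ren h' g) E2)), D'; split=> //.
  - by rewrite -!msetDA [(E4 `+` E2)%mset]msetDC.
  - right; split; first by rewrite -(kcommN _ kc).
    by exists (map_bag (ren h' g) E3), (map_bag (ren h' g) E2), w'; rewrite map_bagD.
  - left; split=> //; apply/gsub_rapp.
    exists D', mset0, v1, (map_bag (ren h g) E2); split=> //; first by rewrite msetD0.
    exact: bmap_fresh.
case=> [[nK' hv]|[eK' _]]; last by case: (kcommNN kc eK eK').
move/gsub_rapp: hv => [? [? [v1 [D2' [/map_bag_eqD[E1 [E2 [-> -> ->]]] hv hD ->]]]]].
have [E3 [E4 [w' [D' [-> h1 h2 h3]]]]] := IH _ _ _ _ _ _ _ _ _ _ kc fr hw hv.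
exists E3, (E4 `+` E2)%mset, w', (D' `+` D2')%mset; split.
- by rewrite msetDA.
- by left; split=> //; rewrite -(kcommN _ kc).
- by rewrite map_bagD; apply: bmapD.
- by right; split=> //; exists D', D2', v1.
Qed.

(** Below a binder the induction hypothesis distributes over a shifted bag; its image is again
    shifted, so the binder can be put back. *)
Lemma bmap_vshift_inv K f g B C D : bmap (gsub (upv K)) (map_bag (ren (S \o f) g) B) (vshift C) D ->
  exists2 D', D = vshift D' & bmap (gsub K) (map_bag (ren f g) B) C D'.
Proof.
rewrite -vshift_ren => /bmap_map_inv; apply=> v _ B' w'; apply: gsub_ren_inv.
by case: K => [k|a] //=; split=> // i ni; rewrite unbumpSS; case: eqP => // _; split=> // -[].
Qed.

Lemma bmap_nshift_inv K f g B C D : bmap (gsub (upn K)) (map_bag (ren f (S \o g)) B) (nshift C) D ->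
  exists2 D', D = nshift D' & bmap (gsub K) (map_bag (ren f g) B) C D'.
Proof.
rewrite -nshift_ren => /bmap_map_inv; apply=> v _ B' w'; apply: gsub_ren_inv.
by case: K => [k|a] //=; split=> //; split=> // b [].
Qed.

Lemma gsub_comm t : commutes_at t.
Proof.
elim/rterm_ind': t => [i|t IH|t C IH IHC|b t IH] K K' Ku h' h g D E w v kc fr.
- have leaf x : gsub Ku mset0 (rvar i) x -> gsub K D x v -> E = mset0 ->
    bmap (gsub K') mset0 D D -> exists E1 E2 w' D',
     [/\ E = (E1 `+` E2)%mset, gsub Ku (map_bag (ren h' g) E1) (rvar i) w',
     bmap (gsub K') (map_bag (ren h g) E2) D D' & gsub K D' w' v].
    by move=> h1 h2 -> h3; exists mset0, mset0, x, D; rewrite msetD0 !map_bag0.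
  move=> /gsub_rvar; case: K kc fr leaf => [k|a] kc fr leaf.
  + case=> [[ik ->] hv|[nik D0 ->] hv].
      (* The leaf is [K] itself: it is replaced by the only element of [D], so all of [E] goes into
         that element. *)
      exists mset0, E, (rvar i), [mset v]%mset; rewrite mset0D map_bag0; split=> //.
      * case: K' kc {hv leaf} => [k' [le ->]|a ->]; apply/gsub_rvar => //.
        right; split=> //; first by lia.
        by rewrite /unbump; congr rvar; lia.
      * exact: bmap1.
      * by apply/gsub_rvar; left.
    rewrite D0 in leaf *; case: K' kc hv leaf => [k' [le ->]|a eKu] /gsub_rvar.
      case=> [[eq /map_bag_eq1[e -> ->]]|[nq /map_bag_eq0 E0 ev]] leaf.
        (* The leaf is the second variable: it is replaced by [e], in which [K] does not occur. *)
        exists [mset e]%mset, mset0, (ren h' g e), mset0; rewrite msetD0 map_bag0 map_bag1.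
        split=> //; first by apply/gsub_rvar; left; split=> //; move: eq; rewrite /unbump; lia.
          exact: bmap0.
        exact: gsub_fresh.
      apply: (leaf (rvar (unbump k'.+1 i))) => //; last exact: bmap0.
      * by apply/gsub_rvar; right; split=> // e; apply: nq; rewrite e /unbump; lia.
      * apply/gsub_rvar; right; split=> //; first by move: nq; rewrite /unbump; lia.
        by rewrite ev; congr rvar; move: nq; rewrite /unbump; lia.
    case=> /map_bag_eq0 E0 ev leaf; apply: (leaf (rvar i)) => //; rewrite ?eKu //; last exact: bmap0.
      exact/gsub_rvar.
    by apply/gsub_rvar; right.
  + case=> D0 ->; rewrite D0 in leaf *.
    case: K' kc leaf => [k' eKu|c [nac eKu]] leaf /gsub_rvar.
      case=> [[eq /map_bag_eq1[e -> ->]]|[nq /map_bag_eq0 E0 ev]].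
        exists [mset e]%mset, mset0, (ren h' g e), mset0; rewrite msetD0 map_bag0 map_bag1 eKu.
        split=> //; [by apply/gsub_rvar; left|exact: bmap0|exact: gsub_fresh].
      apply: (leaf (rvar (unbump k' i))) => //; rewrite ?eKu; last exact: bmap0.
      * by apply/gsub_rvar; right.
      * by apply/gsub_rvar.
    case=> /map_bag_eq0 E0 ev; apply: (leaf (rvar i)) => //; rewrite ?eKu //; last exact: bmap0.
      exact/gsub_rvar.
    exact/gsub_rvar.
- rewrite gsub_rlam => -[w1 hw ->]; rewrite gsub_rlam vshift_ren => -[v1 hv ->].
  have [E1 [E2 [w' [D' [-> h1 h2 h3]]]]] :=
    IH _ _ _ _ _ _ _ _ _ _ (kcomm_upv kc) (freshS_upv fr) hw hv.
  have [D1 eD hD] := bmap_vshift_inv h2.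
  exists E1, E2, (rlam w'), D1; split=> //.
    by apply/gsub_rlam; exists w' => //; rewrite vshift_ren.
  by apply/gsub_rlam; exists v1 => //; rewrite -eD.
- rewrite gsub_rapp => -[D0 [D1 [w1 [W [-> hw hW ->]]]]].
  rewrite gsub_rapp => -[? [? [v1 [V [/map_bag_eqD[E0 [E1 [-> -> ->]]] hv hV ->]]]]].
  have [F1 [F2 [w' [D' [-> h1 h2 h3]]]]] := IH _ _ _ _ _ _ _ _ _ _ kc fr hw hv.
  suff [G1 [G2 [W' [D1' [-> k1 k2 k3]]]]] : exists G1 G2 W' D1',
      [/\ E1 = (G1 `+` G2)%mset, bmap (gsub Ku) (map_bag (ren h' g) G1) C W',
          bmap (gsub K') (map_bag (ren h g) G2) D1 D1' & bmap (gsub K) D1' W' V].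
    exists (F1 `+` G1)%mset, (F2 `+` G2)%mset, (rapp w' W'), (D' `+` D1')%mset; split.
    + by rewrite msetDACA.
    + apply/gsub_rapp; exists (map_bag (ren h' g) F1), (map_bag (ren h' g) G1), w', W'.
      by rewrite map_bagD.
    + by rewrite map_bagD; apply: bmapD.
    + by apply/gsub_rapp; exists D', D1', v1, V.
  elim: hW E1 V IHC hV => {hw hv h1 h2 h3 D0 E0 F1 F2 w' D'} [|B1 B2 c c' C' W' hc _ IHW] E1 V IHC hV.
    have [/map_bag_eq0 -> ->] := bmap_nilP hV.
    by exists mset0, mset0, mset0, mset0; rewrite !map_bag0 msetD0; split=> //; apply: bmap0.
  have [? [? [x [V' [/map_bag_eqD[G1 [G2 [-> -> ->]]] -> hx hV']]]]] := bmap_consP hV.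
  have [||G3 [G4 [W2 [D2 [-> k1 k2 k3]]]]] := IHW G2 V' => //.
    by move=> u uC; apply: IHC; rewrite mset1Dr.
  have cC : c \in (c +` C')%mset by rewrite mset1D1.
  have [F1 [F2 [w' [D' [-> h1 h2 h3]]]]] := IHC _ cC _ _ _ _ _ _ _ _ _ _ kc fr hc hx.
  exists (F1 `+` G3)%mset, (F2 `+` G4)%mset, (w' +` W2)%mset, (D' `+` D2)%mset; split.
  + by rewrite msetDACA.
  + by rewrite map_bagD; apply: bmapS.
  + by rewrite map_bagD; apply: bmapD.
  + exact: bmapS.
- rewrite gsub_rmu => -[w1 hw ->]; rewrite gsub_rmu nshift_ren => -[v1 hv ew].
  have [E1 [E2 [w' [D' [-> h1 h2 h3]]]]] :=
    gnamed_comm_of IH (kcomm_upn kc) (freshS_upn fr) hw hv.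
  have [D1 eD hD] := bmap_nshift_inv h2.
  exists E1, E2, (rmu b w'), D1; split=> //.
    by apply/gsub_rmu; exists w' => //; rewrite nshift_ren.
  by rewrite ew; apply/gsub_rmu; exists v1 => //; rewrite -eD.
Qed.

Lemma gnamed_comm t K K' Ku h' h g D E b w v :
  kcomm K K' Ku -> fresh K h' h g ->
  gnamed K D b t w -> gnamed K' (map_bag (ren h g) E) b w v ->
  exists E1 E2 w' D', [/\ E = (E1 `+` E2)%mset, gnamed Ku (map_bag (ren h' g) E1) b t w',
    bmap (gsub K') (map_bag (ren h g) E2) D D' & gnamed K D' b w' v].
Proof. exact: gnamed_comm_of (@gsub_comm t) _ _ _ _ _ _ _ _ _ _ _. Qed.

(** * One-step reduction to an addend *)

Inductive step : rterm -> rterm -> Prop :=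
| step_lam t B u : gsub (KV 0) B t u -> step (rapp (rlam t) B) u
| step_mu b t B u : gnamed (KN 0) (nshift B) b t u -> step (rapp (rmu b t) B) (rmu b u)
| step_rho a b t : step (rmu a (rmu b t)) (rmu (ninst a b) (ren id (ninst a) t))
| step_ctx_lam t u : step t u -> step (rlam t) (rlam u)
| step_ctx_appl t u B : step t u -> step (rapp t B) (rapp u B)
| step_ctx_appr t v w (B : bag) : step v w -> step (rapp t (v +` B)%mset) (rapp t (w +` B)%mset)
| step_ctx_mu b t u : step t u -> step (rmu b t) (rmu b u).

Lemma stepP t u : step t u <-> exists2 T, rred t T & T u.
Proof.
split.
  elim=> {t u} [t B u h|b t B u h|a b t|t u _ [T h1 h2]|t u B _ [T h1 h2]|
                t v w B _ [T h1 h2]|b t u _ [T h1 h2]].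
  - by exists (lsubst 0 B t) => //; apply: rred_lam.
  - eexists; first exact: rred_mu.
    by exists (b, u) => //=; apply/napp_namedE.
  - by eexists; [exact: rred_rho|].
  - by eexists; [apply: rred_ctx_lam h1|exists u].
  - by eexists; [apply: rred_ctx_appl h1|exists u].
  - by eexists; [apply: rred_ctx_appr h1|exists w].
  - by eexists; [apply: rred_ctx_mu h1|exists u].
case=> T h; elim: h u => {t T} [t B u h|b t B u [[c u'] /napp_namedE[-> h] <-]|a b t u ->|
  t T _ IH u [u' /IH h <-]|t T B _ IH u [u' /IH h <-]|t v V B _ IH u [u' /IH h <-]|
  b t T _ IH u [u' /IH h <-]].
- exact: step_lam.
- exact: step_mu.
- exact: step_rho.
- exact: step_ctx_lam.
- exact: step_ctx_appl.
- exact: step_ctx_appr.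
- exact: step_ctx_mu.
Qed.

Inductive steps : rterm -> rterm -> Prop :=
| steps_refl t : steps t t
| steps_cons t u v : step t u -> steps u v -> steps t v.

Lemma steps1 t u : step t u -> steps t u.
Proof. by move=> h; apply: steps_cons h (steps_refl _). Qed.

Lemma steps_trans t u v : steps t u -> steps u v -> steps t v.
Proof. by move=> h1 h2; elim: h1 h2 => // x y z h _ IH h2; apply: steps_cons h (IH h2). Qed.

Lemma steps_map (p : rterm -> rterm) : (forall t u, step t u -> step (p t) (p u)) ->
  forall t u, steps t u -> steps (p t) (p u).
Proof.
move=> h t u; elim=> [x|x y z /h h1 _ h2]; [exact: steps_refl | exact: steps_cons h1 h2].
Qed.

Lemma steps_rlam t u : steps t u -> steps (rlam t) (rlam u).
Proof. exact/steps_map/step_ctx_lam. Qed.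
Lemma steps_rmu b t u : steps t u -> steps (rmu b t) (rmu b u).
Proof. exact/steps_map/step_ctx_mu. Qed.
Lemma steps_rappl B t u : steps t u -> steps (rapp t B) (rapp u B).
Proof. by apply: (steps_map (p := fun t => rapp t B)) => x y; apply: step_ctx_appl. Qed.
Lemma steps_rappr (B : bag) p t u : steps t u -> steps (rapp p (t +` B)%mset) (rapp p (u +` B)%mset).
Proof. by apply: (steps_map (p := fun t => rapp p (t +` B)%mset)) => x y; apply: step_ctx_appr. Qed.

Lemma step_ren f g t u : step t u -> step (ren f g t) (ren f g u).
Proof.
move=> h; elim: h f g => {t u} [t B u h|b t B u h|a b t|t u _ IH|t u B _ IH|t v w B _ IH|b t u _ IH] f g;
  rewrite !renE.
- apply: step_lam; apply: gsub_ren h.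
  by split=> // -[|i] //= _; split=> //; rewrite /unbump /= !subn1.
- apply: step_mu; rewrite -ren_nshift; apply: gnamed_ren h.
  by split=> //; split=> // -[].
- have -> : up g (ninst a b) = ninst (up g a) (up (up g) b) by case: b.
  have eg : up g \o ninst a =1 ninst (up g a) \o up (up g) by case.
  by rewrite ren_comp (eq_ren (frefl _) eg) -(ren_comp id f); apply: step_rho.
- exact/step_ctx_lam/IH.
- exact/step_ctx_appl/IH.
- by rewrite !map_bagS; apply/step_ctx_appr/IH.
- exact/step_ctx_mu/IH.
Qed.

(** * Postponing inner steps after linear substitution *)

Lemma bmap_bag_step_of K (w w0 : rterm) C : step w0 w ->
  (forall v, v \in C -> forall (B : bag) x, gsub K (w +` B)%mset v x ->
     exists2 x', gsub K (w0 +` B)%mset v x' & step x' x) ->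
  forall (B : bag) D, bmap (gsub K) (w +` B)%mset C D ->
  exists x x' D', [/\ D = (x +` D')%mset, bmap (gsub K) (w0 +` B)%mset C (x' +` D')%mset & step x' x].
Proof.
move=> h0; elim/mset_elim: C => [|c C IH] h B D.
  by move=> /bmap_nilP[/cons_mset_neq0].
move=> /bmap_consP[B1 [B2 [y [D2 [/esym/msetD_eq_cons[] [B' [-> ->]] -> hy hD]]]]].
  have [|x' hx' sx] := h c _ _ _ hy; first by rewrite mset1D1.
  by exists y, x', D2; rewrite msetDA; split=> //; apply: bmapS.
have [|x [x' [D' [-> h2 s2]]]] := IH _ _ _ hD.
  by move=> v vC; apply: h; rewrite mset1Dr.
exists x, x', (y +` D')%mset; rewrite msetDCA; split=> //.
by rewrite msetDCA [X in bmap _ _ _ X]msetDCA; apply: bmapS.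
Qed.

Lemma gnamed_bag_step_of K (w w0 : rterm) t : step w0 w ->
  (forall (B : bag) v, gsub K (w +` B)%mset t v ->
     exists2 v', gsub K (w0 +` B)%mset t v' & step v' v) ->
  forall (B : bag) b v, gnamed K (w +` B)%mset b t v ->
  exists2 v', gnamed K (w0 +` B)%mset b t v' & step v' v.
Proof.
move=> s IH B b v [[nK /IH[v' h' sv]]|[eK [B1 [B2 [u1 [eB hu ->]]]]]].
  by exists v' => //; left.
case/esym/msetD_eq_cons: eB => [] [B' [eB1 eB2]].
  rewrite eB1 in hu; have [u' h' su] := IH _ _ hu.
  exists (rapp u' B2); last exact: step_ctx_appl.
  by right; split=> //; exists (w0 +` B')%mset, B2, u'; rewrite eB2 msetDA.
exists (rapp u1 (w0 +` B')%mset); last by rewrite eB1; apply: step_ctx_appr.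
by right; split=> //; exists B1, (w0 +` B')%mset, u1; rewrite eB2 msetDCA.
Qed.

(** Linearity: an element of the bag lands at exactly one place, so its step becomes one step
    there. *)
Lemma gsub_bag_step K (w w0 : rterm) (B : bag) t v : step w0 w -> gsub K (w +` B)%mset t v ->
  exists2 v', gsub K (w0 +` B)%mset t v' & step v' v.
Proof.
elim/rterm_ind': t K w w0 B v => [i|t IH|t C IH IHC|b t IH] K w w0 B v s.
- case: K => [k|a] /gsub_rvar; last by case=> /cons_mset_neq0.
  case=> [[-> /esym/mset1_eq_cons[-> ->]]|[_ /cons_mset_neq0 //]].
  by exists w0 => //; rewrite msetD0; apply/gsub_rvar; left.
- rewrite gsub_rlam /vshift map_bagS => -[v1 /(IH _ _ _ _ _ (step_ren S id s))[v' h s'] ->].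
  by exists (rlam v'); [apply/gsub_rlam; exists v'; rewrite // /vshift map_bagS|apply: step_ctx_lam].
- rewrite gsub_rapp => -[B0 [B1 [t' [D [/esym/msetD_eq_cons[] [B' [-> ->]] h0 hD ->]]]]].
    have [t1 h1 s1] := IH _ _ _ _ _ s h0.
    exists (rapp t1 D); last exact: step_ctx_appl.
    by apply/gsub_rapp; exists (w0 +` B')%mset, B1, t1, D; rewrite msetDA.
  have [|x [x' [D' [-> h1 s1]]]] := bmap_bag_step_of s _ hD.
    by move=> u uC B2 x; apply: IHC.
  exists (rapp t' (x' +` D')%mset); last exact: step_ctx_appr.
  by apply/gsub_rapp; exists B0, (w0 +` B')%mset, t', (x' +` D')%mset; rewrite msetDCA.
- rewrite gsub_rmu /nshift map_bagS => -[v1 h ->]; have s' := step_ren id S s.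
  have [v' h' sv] := gnamed_bag_step_of s' (fun B v => IH _ _ _ B v s') h.
  exists (rmu b v'); last exact: step_ctx_mu.
  by apply/gsub_rmu; exists v'; rewrite // /nshift map_bagS.
Qed.

Lemma gnamed_bag_step K (w w0 : rterm) (B : bag) b t v : step w0 w -> gnamed K (w +` B)%mset b t v ->
  exists2 v', gnamed K (w0 +` B)%mset b t v' & step v' v.
Proof. by move=> s; apply: (gnamed_bag_step_of s) => B' v'; apply: gsub_bag_step s. Qed.

(** The situation created by [ninst a], which identifies [a.+1] and 0; it is stated for any [g] so
    that it passes below binders. *)
Definition merges (g : nat -> nat) c c' d : Prop :=
  [/\ g c' = c, g d = c, c' <> d & forall b, g b = c -> b = c' \/ b = d].

Lemma merges_up g c c' d : merges g c c' d -> merges (up g) c.+1 c'.+1 d.+1.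
Proof.
case=> e1 e2 n H; split=> [||[]//|[|b] //= [] /H[]->]; rewrite /= ?e1 ?e2; by [|left|right].
Qed.

(** Named application at a merged name is named application at [c'], then at [d], then the merge,
    the bag being split between the two. The bag is free of [d], so the second operation does not
    enter what the first has inserted. *)
Definition merge_at t := forall g c c' d f e h E u, merges g c c' d ->
  (forall x, h x <> d) -> gsub (KN c) (map_bag (ren (f \o e) (g \o h)) E) (ren f g t) u ->
  exists E1 E2 w1 w2, [/\ E = (E1 `+` E2)%mset, gsub (KN c') (map_bag (ren e h) E1) t w1,
    gsub (KN d) (map_bag (ren e h) E2) w1 w2 & u = ren f g w2].

Lemma gnamed_merge_of t : merge_at t -> forall g c c' d f e h E b u, merges g c c' d ->
  (forall x, h x <> d) -> gnamed (KN c) (map_bag (ren (f \o e) (g \o h)) E) (g b) (ren f g t) u ->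
  exists E1 E2 w1 w2, [/\ E = (E1 `+` E2)%mset, gnamed (KN c') (map_bag (ren e h) E1) b t w1,
    gnamed (KN d) (map_bag (ren e h) E2) b w1 w2 & u = ren f g w2].
Proof.
move=> IH g c c' d f e h E b u m fr; have [e1 e2 ncd H] := m.
case=> [[nc /(IH _ _ _ _ _ _ _ _ _ m fr)[E1 [E2 [w1 [w2 [-> h1 h2 ->]]]]]]|].
  exists E1, E2, w1, w2; split=> //; left; split=> // -[] eb; apply: nc;
    by rewrite -eb ?e1 ?e2.
case=> -[] /esym /H eb [? [? [u1 [/map_bag_eqD[Ei [Eo [-> -> ->]]]]]]].
move=> /(IH _ _ _ _ _ _ _ _ _ m fr)[E1 [E2 [w1 [w2 [-> h1 h2 ->]]]]] ->.
case: eb => ->.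
(* A subterm named [c'] gets its outer arguments [Eo] from the first operation, and the second gives
   them the empty bag. If the name is [d], the second operation supplies [Eo]. *)
- exists (E1 `+` Eo)%mset, E2, (rapp w1 (map_bag (ren e h) Eo)), (rapp w2 (map_bag (ren e h) Eo)).
  split.
  + by rewrite -!msetDA [(E2 `+` Eo)%mset]msetDC.
  + by right; split=> //; exists (map_bag (ren e h) E1), (map_bag (ren e h) Eo), w1; rewrite map_bagD.
  + left; split=> [[]/esym//|]; apply/gsub_rapp.
    exists (map_bag (ren e h) E2), mset0, w2, (map_bag (ren e h) Eo); rewrite msetD0; split=> //.
    by apply: bmap_fresh; split.
  + by rewrite renE map_bag_ren.
- exists E1, (E2 `+` Eo)%mset, w1, (rapp w2 (map_bag (ren e h) Eo)); split.
  + by rewrite msetDA.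
  + by left; split=> // -[].
  + by right; split=> //; exists (map_bag (ren e h) E2), (map_bag (ren e h) Eo), w2; rewrite map_bagD.
  + by rewrite renE map_bag_ren.
Qed.

Lemma gsub_merge t : merge_at t.
Proof.
elim/rterm_ind': t => [i|t IH|t C IH IHC|b t IH] g c c' d f e h E u m fr; rewrite renE.
- rewrite gsub_rvar => -[/map_bag_eq0 -> ->].
  exists mset0, mset0, (rvar i), (rvar i); rewrite msetD0 !map_bag0.
  by split=> //; apply/gsub_rvar.
- rewrite gsub_rlam vshift_ren => -[u1 /(IH g c c' d (up f) (S \o e) h _ _ m fr)].
  move=> [E1 [E2 [w1 [w2 [-> h1 h2 ->]]]]] ->; exists E1, E2, (rlam w1), (rlam w2); split=> //.
  + by apply/gsub_rlam; exists w1; rewrite ?vshift_ren.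
  + by apply/gsub_rlam; exists w2; rewrite ?vshift_ren.
- rewrite gsub_rapp => -[? [? [u1 [D [/map_bag_eqD[E0 [E1 [-> -> ->]]] h0 hD ->]]]]].
  have [F1 [F2 [w1 [w2 [-> h1 h2 ->]]]]] := IH _ _ _ _ _ _ _ _ _ m fr h0.
  suff [G1 [G2 [W1 [W2 [-> k1 k2 ->]]]]] : exists G1 G2 W1 W2,
      [/\ E1 = (G1 `+` G2)%mset, bmap (gsub (KN c')) (map_bag (ren e h) G1) C W1,
          bmap (gsub (KN d)) (map_bag (ren e h) G2) W1 W2 & D = map_bag (ren f g) W2].
    exists (F1 `+` G1)%mset, (F2 `+` G2)%mset, (rapp w1 W1), (rapp w2 W2); rewrite renE; split=> //.
    + by rewrite msetDACA.
    + by apply/gsub_rapp; do 4 eexists; split; [exact: map_bagD|exact: h1|exact: k1|].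
    + by apply/gsub_rapp; do 4 eexists; split; [exact: map_bagD|exact: h2|exact: k2|].
  elim/mset_elim: C E1 D IHC hD {h0 h1 h2} => [|v C IHC'] E1 D IHC.
    rewrite map_bag0 => /bmap_nilP[/map_bag_eq0 -> ->].
    by exists mset0, mset0, mset0, mset0; rewrite !map_bag0 msetD0; split=> //; apply: bmap0.
  rewrite map_bagS => /bmap_consP[? [? [x [D' [/map_bag_eqD[G1 [G2 [-> -> ->]]] -> hx hD]]]]].
  have [|G3 [G4 [W1 [W2 [-> k1 k2 ->]]]]] := IHC' _ _ _ hD.
    by move=> z zC; apply: IHC; rewrite mset1Dr.
  have vC : v \in (v +` C)%mset by rewrite mset1D1.
  have [H1 [H2 [x1 [x2 [-> l1 l2 ->]]]]] := IHC _ vC _ _ _ _ _ _ _ _ _ m fr hx.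
  exists (H1 `+` G3)%mset, (H2 `+` G4)%mset, (x1 +` W1)%mset, (x2 +` W2)%mset; split.
  + by rewrite msetDACA.
  + by rewrite map_bagD; apply: bmapS.
  + by rewrite map_bagD; apply: bmapS.
  + by rewrite map_bagS.
- rewrite gsub_rmu nshift_ren => -[u1 hu ->].
  have fr' : forall x, (S \o h) x <> d.+1 by move=> x [] /fr.
  have [E1 [E2 [w1 [w2 [-> h1 h2 ->]]]]] :=
    @gnamed_merge_of _ IH (up g) c.+1 c'.+1 d.+1 f e (S \o h) _ _ _ (merges_up m) fr' hu.
  exists E1, E2, (rmu b w1), (rmu b w2); split=> //.
  + by apply/gsub_rmu; exists w1; rewrite ?nshift_ren.
  + by apply/gsub_rmu; exists w2; rewrite ?nshift_ren.
Qed.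

(* When the outer name is the one to which the inner [mu] is attached, the
   arguments reach the inner [mu] through an application, which has to be
   contracted before the two binders are merged. *)
Lemma gnamed_rho K B a b t u :
  gnamed K (nshift B) (ninst a b) (ren id (ninst a) t) u ->
  exists2 u', gnamed K (nshift B) a (rmu b t) u' & steps (rmu a u') (rmu (ninst a b) u).
Proof.
have eB f : map_bag (ren id (f \o (S \o S))) B = map_bag (ren id f) (nshift (nshift B)).
  by rewrite !nshift_ren map_bag_ren.
case: (pselect (K = KN a)) => [->|nK].
  rewrite /nshift => h; have m : merges (ninst a) a a.+1 0.
    by split=> // -[|x] /= e; [right|left; rewrite e].
  have [|E1 [E2 [w1 [w2 [-> h1 h2 ->]]]]] :=
    @gnamed_merge_of _ (@gsub_merge t) (ninst a) _ _ _ id id (S \o S) B b u m _ h; first by [].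
  (* [E1] is the share of the outer name and is already consumed inside; [E2] is the share of the
     inner name and waits as an argument of the inner [mu]. *)
  exists (rapp (rmu b w1) (nshift E2)).
    right; split=> //; exists (nshift E1), (nshift E2), (rmu b w1).
    split=> //; first exact: map_bagD.
    by apply/gsub_rmu; exists w1; rewrite ?nshift_ren.
  apply: (@steps_cons _ (rmu a (rmu b w2))); last exact/steps1/step_rho.
  by apply/step_ctx_mu/step_mu; rewrite nshift_ren.
(* Now [K] is not the name into which 0 is merged, so the merge changes no occurrence of [K] and can
   be undone. *)
have c : rencompat (upn K) K id id (ninst a).
  case: K nK => [k|c] //= nK; split=> //; split=> // -[|x] /=; last by move=> ->.
  by move=> e; case: nK; rewrite e.
have -> : nshift B = map_bag (ren id (ninst a)) (nshift (nshift B)).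
  by rewrite -[in RHS]eB.
move=> /(gnamed_ren_inv c)[u' -> h]; exists (rmu b u'); last exact/steps1/step_rho.
left; split=> //; rewrite -eB /=; apply/gsub_rmu; exists u' => //.

Qed.

Lemma gnamed_body_of K B b t t1 u :
  (forall B u, gsub K B t1 u -> exists2 u', gsub K B t u' & steps u' u) ->
  gnamed K B b t1 u -> exists2 u', gnamed K B b t u' & steps u' u.
Proof.
move=> IH [[nK /IH[u' h s]]|[eK [B1 [B2 [u1 [-> /IH[u' h s] ->]]]]]].
  by exists u' => //; left.
by exists (rapp u' B2); [right; split=> //; exists B1, B2, u'|apply: steps_rappl].
Qed.

(** The redex of [t] survives the operation and can be contracted afterwards. For the redexes with
    an argument this is the substitution lemma, the argument receiving its share of [B]; only a
    merge of [mu]s can require two steps. *)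
Lemma gsub_body_step K B t t1 u : step t t1 -> gsub K B t1 u ->
  exists2 u', gsub K B t u' & steps u' u.
Proof.
move=> h; elim: h K B u => {t t1} [t D w h|b t D w h|a b t|t t1 _ IH|t t1 D _ IH|
                                   t v w D _ IH|b t t1 _ IH] K B u.
- have kc : kcomm (KV 0) K (upv K) by case: K.
  have fr : fresh (KV 0) S id id by move=> i; rewrite /unbump /= subn1.
  rewrite -[X in gsub K X]map_bag_ren_id => hu.
  have [E1 [E2 [w' [D' [-> h1 h2 h3]]]]] := gsub_comm kc fr h hu.
  rewrite map_bag_ren_id in h2; exists (rapp (rlam w') D'); last exact/steps1/step_lam.
  apply/gsub_rapp; exists E1, E2, (rlam w'), D'; rewrite map_bagD !map_bag_ren_id; split=> //.
  by apply/gsub_rlam; exists w'.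
- have kc : kcomm (KN 0) (upn K) (upn K) by case: K.
  rewrite gsub_rmu => -[u' hu ->].
  have fr : fresh (KN 0) id id S by [].
  have [E1 [E2 [w' [D' [-> h1 h2 h3]]]]] := gnamed_comm kc fr h hu.
  have [D1 eD hD] : exists2 D1, D' = nshift D1 & bmap (gsub K) E2 D D1.
    by rewrite -[E2]map_bag_ren_id; apply: bmap_nshift_inv.
  exists (rapp (rmu b w') D1); last by apply/steps1/step_mu; rewrite -eD.
  by apply/gsub_rapp; exists E1, E2, (rmu b w'), D1; split=> //; apply/gsub_rmu; exists w'.
- rewrite gsub_rmu => -[u' /gnamed_rho[u1 h1 s] ->].
  by exists (rmu a u1) => //; apply/gsub_rmu; exists u1.
- rewrite gsub_rlam => -[u' /IH[u1 h1 s] ->].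
  by exists (rlam u1); [apply/gsub_rlam; exists u1|apply: steps_rlam].
- rewrite gsub_rapp => -[B0 [B1 [t' [D' [-> /IH[u1 h1 s] hD ->]]]]].
  by exists (rapp u1 D'); [apply/gsub_rapp; exists B0, B1, u1, D'|apply: steps_rappl].
- rewrite gsub_rapp => -[B0 [B1 [t' [D' [-> h1 /bmap_consP[B2 [B3 [x [D2 [-> -> /IH[x' hx s] hD]]]]] ->]]]]].
  exists (rapp t' (x' +` D2)%mset); last exact: steps_rappr.
  by apply/gsub_rapp; exists B0, (B2 `+` B3)%mset, t', (x' +` D2)%mset; split=> //; apply: bmapS.
- rewrite gsub_rmu => -[u' /(gnamed_body_of (fun B u => IH _ B u))[u1 h1 s] ->].
  by exists (rmu b u1); [apply/gsub_rmu; exists u1|apply: steps_rmu].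
Qed.

Lemma gnamed_body_step K B b t t1 u : step t t1 -> gnamed K B b t1 u ->
  exists2 u', gnamed K B b t u' & steps u' u.
Proof. by move=> s; apply: gnamed_body_of => B' u'; apply: gsub_body_step. Qed.

(** * Weak head reduction *)

Lemma step_rvar i x : ~ step (rvar i) x.
Proof.
move=> h; have [t et] : exists t, t = rvar i by eexists.
by rewrite -et in h; case: h et => [? ? ? _|? ? ? ? _|? ? ?|? ? _|? ? ? _|? ? ? ? _|? ? ? _]; rdiscr.
Qed.

Lemma step_rlam t x : step (rlam t) x -> exists2 t', step t t' & x = rlam t'.
Proof.
move=> h; have [s es] : exists s, s = rlam t by eexists.
rewrite -es in h; case: h es => {s x} [s B u h|b s B u h|a b s|s u h|s u B h|s v w B h|b s u h]; try rdiscr.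
by move=> /rlam_inj <-; exists u.
Qed.

Lemma step_rmu b t x : step (rmu b t) x ->
  (exists2 t', step t t' & x = rmu b t') \/
  (exists c s, [/\ t = rmu c s & x = rmu (ninst b c) (ren id (ninst b) s)]).
Proof.
move=> h; have [s es] : exists s, s = rmu b t by eexists.
rewrite -es in h; case: h es => {s x} [s B u h|c s B u h|a c s|s u h|s u B h|s v w B h|c s u h]; try rdiscr.
  by move=> /rmu_inj[<- <-]; right; exists c, s.
by move=> /rmu_inj[<- <-]; left; exists u.
Qed.

Lemma step_rapp p B x : step (rapp p B) x ->
  [\/ exists2 t, p = rlam t & gsub (KV 0) B t x,
      exists b t u, [/\ p = rmu b t, x = rmu b u & gnamed (KN 0) (nshift B) b t u],
      exists2 p', step p p' & x = rapp p' B |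
      exists v w C, [/\ B = (v +` C)%mset, step v w & x = rapp p (w +` C)%mset]].
Proof.
move=> h; have [s es] : exists s, s = rapp p B by eexists.
rewrite -es in h; case: h es => {s x} [s C u h|c s C u h|a c s|s u h|s u C h|s v w C h|c s u h]; try rdiscr.
- by move=> /rapp_inj[<- <-]; apply: Or41; exists s.
- by move=> /rapp_inj[<- <-]; apply: Or42; exists c, s, u.
- by move=> /rapp_inj[<- <-]; apply: Or43; exists u.
- by move=> /rapp_inj[<- <-]; apply: Or44; exists v, w, C.
Qed.

Inductive happ : rterm -> rterm -> Prop :=
| happ_lam t B u : gsub (KV 0) B t u -> happ (rapp (rlam t) B) u
| happ_mu b t B u : gnamed (KN 0) (nshift B) b t u -> happ (rapp (rmu b t) B) (rmu b u)
| happ_app p p' B : happ p p' -> happ (rapp p B) (rapp p' B).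

(** Shape only: when the contraction of the head redex is 0, [has_happ p] holds although no
    [happ p x] does. *)
Inductive has_happ : rterm -> Prop :=
| has_happ_lam t B : has_happ (rapp (rlam t) B)
| has_happ_mu b t B : has_happ (rapp (rmu b t) B)
| has_happ_app p B : has_happ p -> has_happ (rapp p B).

Lemma has_happ_rapp p : has_happ p -> exists q B, p = rapp q B.
Proof. by case=> [t B|b t B|q B _]; do 2 eexists. Qed.

Lemma happ_rapp p B x : happ (rapp p B) x ->
  [\/ exists2 t, p = rlam t & gsub (KV 0) B t x,
      exists b t u, [/\ p = rmu b t, x = rmu b u & gnamed (KN 0) (nshift B) b t u] |
      exists2 p', happ p p' & x = rapp p' B].
Proof.
move=> h; have [s es] : exists s, s = rapp p B by eexists.
rewrite -es in h; case: h es => {s x} [s C u h|c s C u h|s u C h].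
- by move=> /rapp_inj[<- <-]; apply: Or31; exists s.
- by move=> /rapp_inj[<- <-]; apply: Or32; exists c, s, u.
- by move=> /rapp_inj[<- <-]; apply: Or33; exists u.
Qed.

Lemma happ_has p x : happ p x -> has_happ p.
Proof.
elim=> [t B u h|b t B u h|q q' B _ h]; by [apply: has_happ_lam|apply: has_happ_mu|apply: has_happ_app].
Qed.

Lemma happ_rlam_rapp t B x : happ (rapp (rlam t) B) x -> gsub (KV 0) B t x.
Proof.
case/happ_rapp => [[s /rlam_inj <- //]|[? [? [? []]]]|[p' /happ_has/has_happ_rapp[? [?]]]]; rdiscr.
Qed.

Lemma happ_rmu_rapp b t B x : happ (rapp (rmu b t) B) x ->
  exists2 u, x = rmu b u & gnamed (KN 0) (nshift B) b t u.
Proof.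
case/happ_rapp => [[s]|[? [? [u [/rmu_inj[<- <-] -> h]]]]|[p' /happ_has/has_happ_rapp[? [?]]]]; try rdiscr.
by exists u.
Qed.

Lemma happ_has_rapp p B x : has_happ p -> happ (rapp p B) x ->
  exists2 p', happ p p' & x = rapp p' B.
Proof.
by move=> /has_happ_rapp[q [C ->]] /happ_rapp[[s]|[? [? [u []]]]|//]; rdiscr.
Qed.

(** A step other than the head step lies in the body of the head redex, in its bag, or in an
    argument further out that the head step leaves alone. A merge of the head [mu] with one just
    below it counts as a step in the body and is handled by [gnamed_rho]. *)
Lemma happ_postpone t t1 : has_happ t -> step t t1 ->
  happ t t1 \/ (has_happ t1 /\ forall t2, happ t1 t2 -> exists2 t', happ t t' & steps t' t2).
Proof.
move=> h; elim: h t1 => {t} [t B|b t B|p B hp IH] t1 /step_rapp.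
- case=> [[s /rlam_inj <- h]|[? [? [? []]]]|[p' /step_rlam[t' s ->] ->]|[v [w [C [-> s ->]]]]].
  + by left; apply: happ_lam.
  + by rdiscr.
  + right; split; first exact: has_happ_lam.
    move=> t2 /happ_rlam_rapp /(gsub_body_step s)[u h st]; exists u => //; exact: happ_lam.
  + right; split; first exact: has_happ_lam.
    move=> t2 /happ_rlam_rapp /(gsub_bag_step s)[u h st]; exists u; last exact: steps1.
    exact: happ_lam.
- case=> [[s]|[? [? [u [/rmu_inj[<- <-] -> h]]]]|[p' /step_rmu[] H ->]|[v [w [C [-> s ->]]]]].
  + by rdiscr.
  + by left; apply: happ_mu.
  + case: H => t' s ->; right; split; first exact: has_happ_mu.
    move=> t2 /happ_rmu_rapp[u -> /(gnamed_body_step s)[u' h st]].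
    by exists (rmu b u'); [apply: happ_mu|apply: steps_rmu].
  + case: H => c [s [-> ->]]; right; split; first exact: has_happ_mu.
    move=> t2 /happ_rmu_rapp[u -> /gnamed_rho[u' h st]].
    by exists (rmu b u') => //; apply: happ_mu.
  + right; split; first exact: has_happ_mu.
    move=> t2 /happ_rmu_rapp[u ->]; rewrite /nshift map_bagS.
    move=> /(gnamed_bag_step (step_ren id S s))[u' h st].
    exists (rmu b u'); last exact/steps1/step_ctx_mu.
    by apply: happ_mu; rewrite /nshift map_bagS.
- case=> [[s e]|[? [? [? [e]]]]|[p' s ->]|[v [w [C [-> s ->]]]]].
  + by have [? [? e']] := has_happ_rapp hp; move: e; rewrite e'; rdiscr.
  + by have [? [? e']] := has_happ_rapp hp; move: e; rewrite e'; rdiscr.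
  + case: (IH _ s) => [h|[h1 h2]]; first by left; apply: happ_app.
    right; split; first exact: has_happ_app.
    move=> t2 /(happ_has_rapp h1)[q /h2[q' hq st] ->].
    by exists (rapp q' B); [apply: happ_app|apply: steps_rappl].
  + right; split; first exact: has_happ_app.
    move=> t2 /(happ_has_rapp hp)[q hq ->]; exists (rapp q (v +` C)%mset); first exact: happ_app.
    exact/steps1/step_ctx_appr.
Qed.

(** The head redex may sit below one [mu] at the root. Two [mu]s at the root are merged, and then no
    other rule applies, since a [mu] has no applicative head redex. *)
Inductive hst : rterm -> rterm -> Prop :=
| hst_app t t' : happ t t' -> hst t t'
| hst_rho a b t : hst (rmu a (rmu b t)) (rmu (ninst a b) (ren id (ninst a) t))
| hst_mu a p p' : happ p p' -> hst (rmu a p) (rmu a p').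

Inductive has_hst : rterm -> Prop :=
| has_hst_app t : has_happ t -> has_hst t
| has_hst_rho a b t : has_hst (rmu a (rmu b t))
| has_hst_mu a p : has_happ p -> has_hst (rmu a p).

Lemma hst_rho_inv a b t x : hst (rmu a (rmu b t)) x -> x = rmu (ninst a b) (ren id (ninst a) t).
Proof.
move=> h; have [s es] : exists s, s = rmu a (rmu b t) by eexists.
rewrite -es in h; case: h es => {s x} [s x|a' b' s|a' p p'].
- by move=> /happ_has/has_happ_rapp[? [? ->]]; rdiscr.
- by move=> /rmu_inj[<-] /rmu_inj[<- <-].
- by move=> /happ_has/has_happ_rapp[? [? ->]] /rmu_inj[_]; rdiscr.
Qed.

Lemma hst_has_mu a p x : has_happ p -> hst (rmu a p) x -> exists2 p', happ p p' & x = rmu a p'.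
Proof.
move=> hp h; have [s es] : exists s, s = rmu a p by eexists.
rewrite -es in h; case: h es => {s x} [s x|a' b' s|a' q q' h].
- by move=> /happ_has/has_happ_rapp[? [? ->]]; rdiscr.
- by have [? [? ->]] := has_happ_rapp hp => /rmu_inj[_]; rdiscr.
- by move=> /rmu_inj[<- <-]; exists q'.
Qed.

Lemma hst_has_app p x : has_happ p -> hst p x -> happ p x.
Proof.
by move=> hp h; case: h hp => [//|a b t|a q q' _] /has_happ_rapp[? [?]]; rdiscr.
Qed.

Lemma hst_postpone t t1 : has_hst t -> step t t1 ->
  hst t t1 \/ (has_hst t1 /\ forall t2, hst t1 t2 -> exists2 t', hst t t' & steps t' t2).
Proof.
case=> {t} [t ht|a b t|a p hp].
- move=> /(happ_postpone ht)[h|[h1 h2]]; first by left; apply: hst_app.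
  right; split; first exact: has_hst_app.
  by move=> t2 /(hst_has_app h1)/h2[t' h s]; exists t' => //; apply: hst_app.
- case/step_rmu => [[t' /step_rmu[[s st ->]|[c [s [-> ->]]]] ->]|[c [s [/rmu_inj[<- <-] ->]]]].
  + right; split; first exact: has_hst_rho.
    move=> t2 /hst_rho_inv ->; eexists; first exact: hst_rho.
    exact/steps1/step_ctx_mu/step_ren.
  + right; split; first exact: has_hst_rho.
    move=> t2 /hst_rho_inv ->; eexists; first exact: hst_rho.
    rewrite renE ren_comp; apply/steps1.
    (* Three nested [mu]s: merging the inner pair or the outer pair first leads to the same
       instantiation of names. *)
    have -> : ninst a (ninst b c) = ninst (ninst a b) (up (ninst a) c) by case: c.
    have eg : ninst a \o ninst b =1 ninst (ninst a b) \o up (ninst a) by case.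
    by rewrite (eq_ren (frefl _) eg) -(ren_comp id id); apply: step_rho.
  + by left; apply: hst_rho.
- case/step_rmu => [[p' /(happ_postpone hp)[h|[h1 h2]] ->]|[c [s [e _]]]].
  + by left; apply: hst_mu.
  + right; split; first exact: has_hst_mu.
    move=> t2 /(hst_has_mu h1)[q /h2[q' hq s] ->].
    by exists (rmu a q'); [apply: hst_mu|apply: steps_rmu].
  + by have [? [? e']] := has_happ_rapp hp; move: e; rewrite e'; rdiscr.
Qed.

Definition normal u := forall T, ~ rred u T.

Lemma has_happ_rred t : has_happ t -> exists T, rred t T.
Proof.
elim=> [s B|b s B|p B _ [T h]]; eexists; [exact: rred_lam|exact: rred_mu|exact: rred_ctx_appl h].
Qed.

Lemma has_hst_rred t : has_hst t -> exists T, rred t T.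
Proof.
case=> [s /has_happ_rred //|a b s|a p /has_happ_rred[T h]]; eexists; [exact: rred_rho|exact: rred_ctx_mu h].
Qed.

Lemma happ_step t u : happ t u -> step t u.
Proof.
by elim=> [s B x|b s B x|p q B _]; [apply: step_lam|apply: step_mu|apply: step_ctx_appl].
Qed.

Lemma hst_step t u : hst t u -> step t u.
Proof.
by case=> [s x /happ_step//|a b s|a p p' /happ_step]; [apply: step_rho|apply: step_ctx_mu].
Qed.

(** The head redex persists until it is contracted and a normal term has none, so the path contracts
    it somewhere; that contraction is moved to the front. *)
Lemma hst_first t u : has_hst t -> steps t u -> normal u -> exists2 t', hst t t' & steps t' u.
Proof.
move=> ht h; elim: h ht => {t u} [t /has_hst_rred[T h] /(_ T) //|t t1 u s st IH ht nu].
case: (hst_postpone ht s) => [h|[h1 h2]]; first by exists t1.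
have [t2 /h2[t' h s'] s2] := IH h1 nu; exists t' => //; exact: steps_trans s' s2.
Qed.

(** * Head reduction of lambda-mu terms and Taylor expansion *)

Fixpoint lren (f g : nat -> nat) (M : lterm) : lterm :=
  match M with
  | Var i => Var (f i)
  | Lam M => Lam (lren (up f) g M)
  | App M N => App (lren f g M) (lren f g N)
  | Mu b M => Mu (up g b) (lren f (up g) M)
  end.

Definition lnamed K N b M := if K is KN a then if a == b then App M N else M else M.

(** For [KV] this is the usual substitution, for [KN] the structural substitution that turns every
    a|M| into a|M N|. *)
Fixpoint lgsub (K : kind) (N M : lterm) : lterm :=
  match M with
  | Var i => if K is KV k then if i == k then N else Var (unbump k i) else Var i
  | Lam M => Lam (lgsub (upv K) (lren S id N) M)
  | App P Q => App (lgsub K N P) (lgsub K N Q)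
  | Mu b M => Mu b (lnamed (upn K) (lren id S N) b (lgsub (upn K) (lren id S N) M))
  end.

Inductive lhapp : lterm -> lterm -> Prop :=
| lhapp_lam M N : lhapp (App (Lam M) N) (lgsub (KV 0) N M)
| lhapp_mu b M N :
    lhapp (App (Mu b M) N) (Mu b (lnamed (KN 0) (lren id S N) b (lgsub (KN 0) (lren id S N) M)))
| lhapp_app P P' N : lhapp P P' -> lhapp (App P N) (App P' N).

Inductive lhst : lterm -> lterm -> Prop :=
| lhst_app M M' : lhapp M M' -> lhst M M'
| lhst_rho a b M : lhst (Mu a (Mu b M)) (Mu (ninst a b) (lren id (ninst a) M))
| lhst_mu a P P' : lhapp P P' -> lhst (Mu a P) (Mu a P').

(** * Taylor expansion of renamings, substitutions and head steps *)

Definition bag_in (X : set rterm) (B : bag) : Prop := forall v, v \in B -> X v.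

Lemma bag_in0 X : bag_in X mset0.
Proof. by move=> v; rewrite in_mset0. Qed.

Lemma bag_in1 (X : set rterm) v : X v -> bag_in X [mset v]%mset.
Proof. by move=> h w; rewrite in_mset1 => /eqP ->. Qed.

Lemma bag_inD X B C : bag_in X (B `+` C)%mset <-> bag_in X B /\ bag_in X C.
Proof.
split=> [h|[h1 h2] v]; last by rewrite in_msetD => /orP[/h1|/h2].
by split=> v vB; apply: h; rewrite in_msetD vB ?orbT.
Qed.

Lemma bag_inS X v (C : bag) : bag_in X (v +` C)%mset <-> X v /\ bag_in X C.
Proof.
rewrite bag_inD; split=> -[h1 h2]; split=> //; last exact: bag_in1.
by apply: h1; rewrite mset11.
Qed.

Lemma bag_in_map p (X Y : set rterm) B : (forall u, Y u <-> exists2 v, X v & p v = u) ->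
  bag_in Y B <-> exists2 C, bag_in X C & B = map_bag p C.
Proof.
move=> h; split=> [|[C hC -> u /mem_map_bag[v /hC Xv ->]]]; last by apply/h; exists v.
elim/mset_elim: B => [_|u B IH /bag_inS[/h[v Xv <-] /IH[C hC ->]]].
  by exists mset0; rewrite ?map_bag0 //; apply: bag_in0.
by exists (v +` C)%mset; rewrite ?map_bagS //; apply/bag_inS.
Qed.

Lemma taylor_app M N u : taylor (App M N) u <->
  exists t B, [/\ taylor M t, bag_in (taylor N) B & u = rapp t B].
Proof.
split=> [[t ht [B hB <-]]|[t [B [ht hB ->]]]]; first by exists t, B.
by exists t => //; exists B.
Qed.

Lemma taylor_lren f g M u : taylor (lren f g M) u <-> exists2 t, taylor M t & ren f g t = u.
Proof.
elim: M f g u => [i|M IH|M IHM N IHN|b M IH] f g u.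
- by split=> [->|[t -> <-]]; first by exists (rvar i).
- split=> [[u' /IH[t ht <-] <-]|[_ [t ht <-] <-]]; first by exists (rlam t) => //; exists t.
  by exists (ren (up f) g t) => //; apply/IH; exists t.
- rewrite taylor_app; split=> [[? [? [/IHM[t ht <-] /(bag_in_map _ (IHN f g))[B hB ->] ->]]]|
                               [x /taylor_app[t [B [ht hB ->]]] <-]].
    by exists (rapp t B); [apply/taylor_app; exists t, B|rewrite renE].
  exists (ren f g t), (map_bag (ren f g) B); split; last by rewrite renE.
    by apply/IHM; exists t.
  by apply/(bag_in_map _ (IHN f g)); exists B.
- split=> [[u' /IH[t ht <-] <-]|[_ [t ht <-] <-]]; first by exists (rmu b t) => //; exists t.
  by exists (ren f (up g) t) => //; apply/IH; exists t.
Qed.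

Lemma bag_taylor_lren f g M B : bag_in (taylor (lren f g M)) B <->
  exists2 C, bag_in (taylor M) C & B = map_bag (ren f g) C.
Proof. exact: bag_in_map (taylor_lren f g M). Qed.

(** The shares used by the elements of [D] are united in one bag over [Y]; conversely any part of a
    bag over [Y] is again a bag over [Y]. *)
Lemma bmap_gather (R : bag -> rterm -> rterm -> Prop) (X Y Z : set rterm) :
  (forall d, Z d <-> exists c B, [/\ X c, bag_in Y B & R B c d]) ->
  forall D, bag_in Z D <-> exists C B, [/\ bag_in X C, bag_in Y B & bmap R B C D].
Proof.
move=> h D; split=> [|[C [B [hC hB hb]]]].
  elim/mset_elim: D => [_|d D IH /bag_inS[/h[c [B1 [Xc hB1 hR]]] /IH[C [B [hC hB hD]]]]].
    by exists mset0, mset0; split; [exact: bag_in0|exact: bag_in0|exact: bmap0].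
  exists (c +` C)%mset, (B1 `+` B)%mset; split; [exact/bag_inS|exact/bag_inD|exact: bmapS].
elim: hb hC hB => [_ _|B1 B2 v w C' D' hv _ IH /bag_inS[Xv hC] /bag_inD[hB1 hB2]]; first exact: bag_in0.
by apply/bag_inS; split; [apply/h; exists v, B1|exact: IH].
Qed.

Lemma taylor_lnamed_of K N M :
  (forall u, taylor (lgsub K N M) u <->
     exists t B, [/\ taylor M t, bag_in (taylor N) B & gsub K B t u]) ->
  forall b u, taylor (lnamed K N b (lgsub K N M)) u <->
     exists t B, [/\ taylor M t, bag_in (taylor N) B & gnamed K B b t u].
Proof.
move=> h b u; rewrite /lnamed; case: K h => [k|a] h.
  rewrite h; split=> -[t [B [ht hB hg]]]; exists t, B; split=> //; first by left.
  by case: hg => [[]//|[]].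
case: eqP => [<-|nab].
  rewrite taylor_app; split=> [[u1 [B2 [/h[t [B1 [ht hB1 hg]]] hB2 ->]]]|].
    exists t, (B1 `+` B2)%mset; split=> //; first exact/bag_inD.
    by right; split=> //; exists B1, B2, u1.
  move=> [t [B [ht hB [[]//|[_ [B1 [B2 [u1 [eB hg ->]]]]]]]]].
  move: hB; rewrite eB => /bag_inD[hB1 hB2]; exists u1, B2; split=> //.
  by apply/h; exists t, B1.
rewrite h; split=> -[t [B [ht hB hg]]]; exists t, B; split=> //; first by left; split=> // -[].
by case: hg => [[]//|[[]]].
Qed.

(** Taylor expansion commutes with substitution because every inserted copy of [N] is expanded
    independently, and the bag collects these choices. *)
Lemma taylor_lgsub K N M u : taylor (lgsub K N M) u <->
  exists t B, [/\ taylor M t, bag_in (taylor N) B & gsub K B t u].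
Proof.
elim: M K N u => [i|M IH|P IHP Q IHQ|b M IH] K N u.
- split; last first.
    move=> [_ [B [-> hB /gsub_rvar]]]; case: K => [k|a] /=; last by case=> _ ->.
    case=> [[-> eB]|[/eqP/negPf -> _ ->]] //; rewrite eqxx; apply: hB.
    by rewrite eB mset11.
  case: K => [k|a] /=; last first.
    by move=> ->; exists (rvar i), mset0; split=> //; [exact: bag_in0|exact/(gsub_rvar (KN a))].
  case: eqP => [->|nik] hu.
    exists (rvar k), [mset u]%mset; split=> //; first exact: bag_in1.
    by apply/(gsub_rvar (KV k)); left.
  exists (rvar i), mset0; split=> //; first exact: bag_in0.
  by apply/(gsub_rvar (KV k)); right.
- split=> [[u' /IH[t [B [ht /bag_taylor_lren[C hC ->] hg]]] <-]|].
    exists (rlam t), C; split=> //; first by exists t.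
    by apply/gsub_rlam; exists u'.
  move=> [_ [B [[t ht <-] hB /gsub_rlam[u' hg ->]]]]; exists u' => //.
  by apply/IH; exists t, (vshift B); split=> //; apply/bag_taylor_lren; exists B.
- rewrite taylor_app; split.
    move=> [u' [D [/IHP[t [B [ht hB hg]]] /(bmap_gather (IHQ K N))[C [B' [hC hB' hD]]] ->]]].
    exists (rapp t C), (B `+` B')%mset; split.
    + by apply/taylor_app; exists t, C.
    + exact/bag_inD.
    + by apply/gsub_rapp; exists B, B', u', D.
  move=> [_ [B [/taylor_app[t [C [ht hC ->]]] hB]]].
  move=> /gsub_rapp[B0 [B1 [t' [D [eB h0 h1 ->]]]]].
  move: hB; rewrite eB => /bag_inD[hB0 hB1]; exists t', D; split=> //.
    by apply/IHP; exists t, B0.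
  by apply/(bmap_gather (IHQ K N)); exists C, B1.
- split.
    move=> [u' /(taylor_lnamed_of (IH _ _))[t [B [ht /bag_taylor_lren[C hC ->] hg]]] <-].
    exists (rmu b t), C; split=> //; first by exists t.
    by apply/gsub_rmu; exists u'.
  move=> [_ [B [[t ht <-] hB /gsub_rmu[u' hg ->]]]]; exists u' => //.
  apply/(taylor_lnamed_of (IH _ _)).
  by exists t, (nshift B); split=> //; apply/bag_taylor_lren; exists B.
Qed.

Lemma taylor_lnamed K N M b u : taylor (lnamed K N b (lgsub K N M)) u <->
     exists t B, [/\ taylor M t, bag_in (taylor N) B & gnamed K B b t u].
Proof. by apply: taylor_lnamed_of => v; apply: taylor_lgsub. Qed.

Lemma taylor_lhapp M M' : lhapp M M' ->
  [/\ forall t, taylor M t -> has_happ t,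
      forall t t', taylor M t -> happ t t' -> taylor M' t' &
      forall t', taylor M' t' -> exists2 t, taylor M t & happ t t'].
Proof.
elim=> {M M'} [M N|b M N|P P' N _ [h1 h2 h3]].
- split.
  + by move=> _ /taylor_app[_ [B [[t _ <-] _ ->]]]; apply: has_happ_lam.
  + move=> _ t' /taylor_app[_ [B [[t ht <-] hB ->]]] /happ_rlam_rapp hg.
    by apply/taylor_lgsub; exists t, B.
  + move=> t' /taylor_lgsub[t [B [ht hB hg]]]; exists (rapp (rlam t) B); last exact: happ_lam.
    by apply/taylor_app; exists (rlam t), B; split=> //; exists t.
- split.
  + by move=> _ /taylor_app[_ [B [[t _ <-] _ ->]]]; apply: has_happ_mu.
  + move=> _ t' /taylor_app[_ [B [[t ht <-] hB ->]]] /happ_rmu_rapp[u -> hg].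
    exists u => //; apply/taylor_lnamed; exists t, (nshift B); split=> //.
    by apply/bag_taylor_lren; exists B.
  + move=> _ [u /taylor_lnamed[t [_ [ht /bag_taylor_lren[B hB ->] hg]]] <-].
    exists (rapp (rmu b t) B); last exact: happ_mu.
    by apply/taylor_app; exists (rmu b t), B; split=> //; exists t.
- split.
  + by move=> _ /taylor_app[t [B [/h1 ht _ ->]]]; apply: has_happ_app.
  + move=> _ t' /taylor_app[t [B [ht hB ->]]] /(happ_has_rapp (h1 _ ht))[p hp ->].
    by apply/taylor_app; exists p, B; split=> //; apply: h2 hp.
  + move=> _ /taylor_app[p [B [/h3[t ht hp] hB ->]]]; exists (rapp t B); last exact: happ_app.
    by apply/taylor_app; exists t, B.
Qed.

(** The first two parts, with [hst_first], push a path from [taylor M] into [taylor M']; the third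
    puts a head step before a path from [taylor M']. *)
Lemma taylor_lhst M M' : lhst M M' ->
  [/\ forall t, taylor M t -> has_hst t,
      forall t t', taylor M t -> hst t t' -> taylor M' t' &
      forall t', taylor M' t' -> exists2 t, taylor M t & hst t t'].
Proof.
case=> {M M'} [M M' /taylor_lhapp[h1 h2 h3]|a b M|a P P' /taylor_lhapp[h1 h2 h3]].
- split.
  + by move=> t /h1; apply: has_hst_app.
  + by move=> t t' ht; move/h1: (ht) => hh /(hst_has_app hh); apply: h2.
  + by move=> t' /h3[t ht hh]; exists t => //; apply: hst_app.
- split.
  + by move=> _ [_ [t _ <-] <-]; apply: has_hst_rho.
  + move=> _ t' [_ [t ht <-] <-] /hst_rho_inv ->.
    by exists (ren id (ninst a) t) => //; apply/taylor_lren; exists t.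
  + move=> _ [_ /taylor_lren[t ht <-] <-]; exists (rmu a (rmu b t)); last exact: hst_rho.
    by exists (rmu b t) => //; exists t.
- split.
  + by move=> _ [t /h1 ht <-]; apply: has_hst_mu.
  + by move=> _ t' [t ht <-] /(hst_has_mu (h1 _ ht))[p hp ->]; exists p => //; apply: h2 hp.
  + by move=> _ [p /h3[t ht hp] <-]; exists (rmu a t); [exists t|apply: hst_mu].
Qed.

Definition Nf M : set rterm := [set u | normal u /\ exists2 t, taylor M t & steps t u].

Lemma Nf_lhst M M' : lhst M M' -> Nf M = Nf M'.
Proof.
move=> /taylor_lhst[h1 h2 h3]; apply/seteqP; split=> u [nu [t ht s]]; split=> //.
  by have [t' hh s'] := hst_first (h1 _ ht) s nu; exists t' => //; apply: h2 hh.
by have [t0 ht0 /hst_step s0] := h3 _ ht; exists t0 => //; apply: steps_cons s0 s.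
Qed.

(** * Termination *)

Definition msum (F : rterm -> nat) (B : bag) : nat := sumn (map F B).

Lemma msum_seq F (s : seq rterm) : msum F (seq_mset s) = sumn (map F s).
Proof. exact/perm_sumn/perm_map/perm_eq_seq_mset. Qed.

Lemma msum0 F : msum F mset0 = 0.
Proof. by rewrite -mset_nil msum_seq. Qed.

Lemma msumS F v (B : bag) : msum F (v +` B)%mset = F v + msum F B.
Proof. by rewrite -{1}[B]seq_mset_id -mset_cons msum_seq. Qed.

Lemma msumD F (B C : bag) : msum F (B `+` C)%mset = msum F B + msum F C.
Proof.
by rewrite -{1}[B]seq_mset_id -{1}[C]seq_mset_id -mset_cat msum_seq map_cat sumn_cat.
Qed.

Lemma msum_map F p (B : bag) : msum F (map_bag p B) = msum (F \o p) B.
Proof. by rewrite /map_bag msum_seq -map_comp. Qed.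

Lemma eq_in_msum F G (B : bag) : (forall v, v \in B -> F v = G v) -> msum F B = msum G B.
Proof. by move=> h; rewrite /msum; congr sumn; apply/eq_in_map. Qed.

Lemma msum_eq0 F (B : bag) : (forall v, v \in B -> F v = 0) -> msum F B = 0.
Proof.
elim/mset_elim: B => [|v B IH] h; first by rewrite msum0.
by rewrite msumS h ?mset1D1 // IH // => w wB; apply: h; rewrite mset1Dr.
Qed.

Fixpoint pbind (t : praw) : nat :=
  match t with
  | PVar _ => 0
  | PLam t => (pbind t).+1
  | PApp t vs => pbind t + sumn (map pbind vs)
  | PMu _ t => (pbind t).+1
  end.

(** The first component is the price of an application whose function is [t],
    the second maps a name to the sum of the prices of the subterms that it
    names: the price of [mu] covers all the applications that contracting a
    [mu]-redex creates. *)
Fixpoint pprice (t : praw) : nat * (nat -> nat) :=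
  match t with
  | PVar _ => (1, fun=> 0)
  | PLam t => (1, (pprice t).2)
  | PApp t vs => ((pprice t).1, fun a => (pprice t).2 a + sumn (map (fun v => (pprice v).2 a) vs))
  | PMu b t => (((b == 0) * (pprice t).1 + (pprice t).2 0).+1,
                fun a => (b == a.+1) * (pprice t).1 + (pprice t).2 a.+1)
  end.

(** Contracting a [mu]-redex destroys an application priced p + 1 and creates applications of total
    price p: the successor in the price of [PMu] pays for the strict decrease. *)
Fixpoint ptotal (t : praw) : nat :=
  match t with
  | PVar _ => 0
  | PLam t => ptotal t
  | PApp t vs => ptotal t + sumn (map ptotal vs) + (pprice t).1
  | PMu _ t => ptotal t
  end.

Definition binders (t : rterm) := pbind t.
Definition price (t : rterm) := (pprice t).1.
Definition nprice (a : nat) (t : rterm) := (pprice t).2 a.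
Definition total (t : rterm) := ptotal t.

Lemma sumn_rapp (F : praw -> nat) (B : bag) :
  sumn (map F (sort praw_le [seq rval u | u <- B])) = msum (F \o rval) B.
Proof. by rewrite /msum map_comp; apply/perm_sumn/perm_map; rewrite perm_sort. Qed.

Lemma binders_rapp t B : binders (rapp t B) = binders t + msum binders B.
Proof. by rewrite /binders /= sumn_rapp. Qed.
Lemma price_rapp t B : price (rapp t B) = price t. Proof. by []. Qed.
Lemma nprice_rapp a t B : nprice a (rapp t B) = nprice a t + msum (nprice a) B.
Proof. by rewrite /nprice /= sumn_rapp. Qed.
Lemma total_rapp t B : total (rapp t B) = total t + msum total B + price t.
Proof. by rewrite /total /= sumn_rapp. Qed.
Lemma binders_rlam t : binders (rlam t) = (binders t).+1. Proof. by []. Qed.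
Lemma binders_rmu b t : binders (rmu b t) = (binders t).+1. Proof. by []. Qed.
Lemma price_rmu b t : price (rmu b t) = ((b == 0) * price t + nprice 0 t).+1. Proof. by []. Qed.
Lemma nprice_rmu a b t : nprice a (rmu b t) = (b == a.+1) * price t + nprice a.+1 t. Proof. by []. Qed.
Lemma nprice_rlam a t : nprice a (rlam t) = nprice a t. Proof. by []. Qed.
Lemma total_rmu b t : total (rmu b t) = total t. Proof. by []. Qed.
Lemma total_rlam t : total (rlam t) = total t. Proof. by []. Qed.

Lemma binders_ren f g t : binders (ren f g t) = binders t.
Proof.
elim/rterm_ind': t f g => [i|t IH|t C IH IHC|b t IH] f g; rewrite renE.
- by [].
- by rewrite !binders_rlam IH.
- by rewrite !binders_rapp IH msum_map; congr addn; apply: eq_in_msum => v vC; apply: IHC.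
- by rewrite !binders_rmu IH.
Qed.

Lemma price_ren f g t : price (ren f g t) = price t /\
  forall c, (forall b, g b = g c -> b = c) -> nprice (g c) (ren f g t) = nprice c t.
Proof.
elim/rterm_ind': t f g => [i|t IH|t C IH IHC|b t IH] f g; rewrite renE.
- by [].
- by split=> // c /(IH (up f) g).2.
- rewrite !price_rapp; split=> [|c hc]; first exact: (IH f g).1.
  rewrite !nprice_rapp (IH f g).2 // msum_map; congr addn.
  by apply: eq_in_msum => v vC; apply: (IHC v vC f g).2.
- have [h1 h2] := IH f (up g); split=> [|c hc].
    by rewrite !price_rmu h1 (h2 0) //; [case: b|case].
  have hc' d : up g d = up g c.+1 -> d = c.+1 by case: d => // d [] /hc ->.
  rewrite !nprice_rmu h1 (h2 _ hc'); congr (nat_of_bool _ * _ + _).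
  by apply/eqP/eqP => [/hc'|->].
Qed.

Lemma nprice_ren0 f g c t : (forall b, g b <> c) -> nprice c (ren f g t) = 0.
Proof.
elim/rterm_ind': t f g c => [i|t IH|t C IH IHC|b t IH] f g c hc; rewrite renE.
- by [].
- by rewrite nprice_rlam IH.
- rewrite nprice_rapp IH // msum_map msum_eq0 // => v vC; exact: IHC.
- rewrite nprice_rmu IH; last by case=> //= d [] /hc.
  by rewrite addn0; case: eqP => // e; case: b e => //= b [] /hc.
Qed.

Lemma msum_nprice_nshift0 B : msum (nprice 0) (nshift B) = 0.
Proof. by rewrite msum_map msum_eq0 // => v _; apply: nprice_ren0. Qed.

Lemma msum_nprice_nshiftS c B : msum (nprice c.+1) (nshift B) = msum (nprice c) B.
Proof.
by rewrite msum_map; apply: eq_in_msum => v _; apply: (price_ren id S v).2 => b [].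
Qed.

Lemma total_ren f g t : total (ren f g t) = total t.
Proof.
elim/rterm_ind': t f g => [i|t IH|t C IH IHC|b t IH] f g; rewrite renE.
- by [].
- by rewrite !total_rlam IH.
- rewrite !total_rapp IH msum_map (price_ren f g t).1; congr (_ + _ + _).
  by apply: eq_in_msum => v vC; apply: IHC.
- by rewrite !total_rmu IH.
Qed.

Lemma msum_ren F f g B : (forall t, F (ren f g t) = F t) -> msum F (map_bag (ren f g) B) = msum F B.
Proof. by move=> h; rewrite msum_map; apply: eq_in_msum => v _; apply: h. Qed.

Lemma bmap_msum (R : bag -> rterm -> rterm -> Prop) (F F' G : rterm -> nat) B C D :
  (forall v, v \in C -> forall B w, R B v w -> F w = F' v + msum G B) ->
  bmap R B C D -> msum F D = msum F' C + msum G B.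
Proof.
move=> h hb; elim: hb h => [|B1 B2 v w C' D' hv _ IH] h; first by rewrite !msum0.
rewrite !msumS msumD (h v _ _ _ hv) ?mset1D1 // IH; first by rewrite addnACA.
by move=> x xC; apply: h; rewrite mset1Dr.
Qed.

Lemma gnamed_binders_of K t :
  (forall B u, gsub K B t u -> binders u = binders t + msum binders B) ->
  forall B b u, gnamed K B b t u -> binders u = binders t + msum binders B.
Proof.
move=> IH B b u [[_ /IH //]|[_ [B1 [B2 [u1 [-> /IH h ->]]]]]].
by rewrite binders_rapp h msumD addnA.
Qed.

Lemma gsub_binders K B t u : gsub K B t u -> binders u = binders t + msum binders B.
Proof.
elim/rterm_ind': t K B u => [i|t IH|t C IH IHC|b t IH] K B u.
- move/gsub_rvar; case: K => [k [[_ ->]|[_ -> ->]]|a [-> ->]]; rewrite ?msum0 //.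
  by rewrite -[[mset u]%mset]msetD0 msumS msum0 addn0.
- rewrite gsub_rlam => -[u' /IH h ->]; rewrite !binders_rlam h msum_ren //.
  exact: binders_ren.
- rewrite gsub_rapp => -[B0 [B1 [t' [D [-> /IH h hD ->]]]]].
  rewrite !binders_rapp h msumD addnACA; congr addn.
  by apply: bmap_msum hD => v vC B' w; apply: IHC.
- rewrite gsub_rmu => -[u' /(gnamed_binders_of (fun B u => IH _ B u)) h ->].
  by rewrite !binders_rmu h msum_ren //; apply: binders_ren.
Qed.

Lemma gnamed_binders K B b t u : gnamed K B b t u -> binders u = binders t + msum binders B.
Proof. by apply: gnamed_binders_of => B' u'; apply: gsub_binders. Qed.

(** One application is created at each subterm named [a], at the price of that subterm; their sum is
    [nprice a t]. Arguments do not alter a price, since an application costs as much to apply as its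
    function. *)
Definition priced_at t := forall a B u, gsub (KN a) B t u ->
  [/\ price u = price t, forall c, nprice c u = nprice c t + msum (nprice c) B &
      total u = total t + msum total B + nprice a t].

Lemma gnamed_price_of t : priced_at t -> forall a B b u, gnamed (KN a) B b t u ->
  [/\ price u = price t, forall c, nprice c u = nprice c t + msum (nprice c) B &
      total u = total t + msum total B + nprice a t + (b == a) * price t].
Proof.
move=> IH a B b u [[n /IH[h1 h2 h3]]|[[->] [B1 [B2 [u1 [-> /IH[h1 h2 h3] ->]]]]]].
  by split=> //; rewrite h3; case: eqP => [e|_]; [case: n; rewrite e|rewrite addn0].
split; first by rewrite price_rapp.
  by move=> c; rewrite nprice_rapp h2 msumD addnA.
by rewrite total_rapp h1 h3 msumD eqxx; lia.
Qed.

Lemma gsub_price t : priced_at t.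
Proof.
elim/rterm_ind': t => [i|t IH|t C IH IHC|b t IH] a B u.
- by move/gsub_rvar => [-> ->]; split=> [//|c|]; rewrite msum0 ?addn0.
- rewrite gsub_rlam => -[u' /IH[h1 h2 h3] ->]; split=> // [c|].
    rewrite !nprice_rlam h2 msum_ren // => v.
    by apply: (price_ren S id v).2.
  by rewrite !total_rlam h3 msum_ren //; apply: total_ren.
- rewrite gsub_rapp => -[B0 [B1 [t' [D [-> /IH[h1 h2 h3] hD ->]]]]]; split=> // [c|].
    rewrite !nprice_rapp h2 msumD addnACA; congr addn.
    by apply: bmap_msum hD => v vC B' w /(IHC v vC)[].
  rewrite !total_rapp nprice_rapp h3 h1 msumD.
  suff -> : msum total D = msum (fun v => total v + nprice a v) C + msum total B1.
    have -> : msum (fun v => total v + nprice a v) C = msum total C + msum (nprice a) C.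
      elim/mset_elim: (C) => [|v C' IH']; first by rewrite !msum0.
      by rewrite !msumS IH' addnACA.
    lia.
  by apply: bmap_msum hD => v vC B' w /(IHC v vC)[_ _ ->]; rewrite addnAC.
- rewrite gsub_rmu => -[u' /(gnamed_price_of IH)[h1 h2 h3] ->].
  have e0 := msum_nprice_nshift0 B.
  split=> [|c|].
  + by rewrite !price_rmu h1 h2 e0 addn0.
  + by rewrite !nprice_rmu h1 h2 msum_nprice_nshiftS addnA.
  + by rewrite !total_rmu h3 nprice_rmu msum_ren ?addnA 1?addnAC //; apply: total_ren.
Qed.

Lemma gnamed_price t a B b u : gnamed (KN a) B b t u ->
  [/\ price u = price t, forall c, nprice c u = nprice c t + msum (nprice c) B &
      total u = total t + msum total B + nprice a t + (b == a) * price t].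
Proof. exact/gnamed_price_of/gsub_price. Qed.

(** A lexicographic decrease: linear substitution and merging each consume a binder, while a
    [mu]-redex keeps its binder and lowers [total]. The prices are preserved in the second case
    because surrounding applications are charged with them. *)
Lemma step_decr t u : step t u ->
  binders u < binders t \/
  [/\ binders u = binders t, total u < total t, price u = price t &
      forall c, nprice c u = nprice c t].
Proof.
elim=> {t u} [t B u h|b t B u h|a b t|t u _ IH|t u B _ IH|t v w B _ IH|b t u _ IH].
- by left; rewrite (gsub_binders h) binders_rapp binders_rlam; lia.
- right; have [h1 h2 h3] := gnamed_price h.
  have e0 := msum_nprice_nshift0 B.
  split.
  + rewrite binders_rapp !binders_rmu (gnamed_binders h) msum_ren //; exact: binders_ren.
  + rewrite total_rapp !total_rmu price_rmu h3 msum_ren; [lia|exact: total_ren].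
  + by rewrite price_rapp !price_rmu h1 h2 e0 addn0.
  + move=> c; rewrite nprice_rapp !nprice_rmu h1 h2 addnA.
    by rewrite msum_nprice_nshiftS.
- by left; rewrite !binders_rmu binders_ren.
- by case: IH => [h|[h1 h2 h3 h4]]; [left|right; split=> //]; rewrite !binders_rlam ?h1.
- case: IH => [h|[h1 h2 h3 h4]]; [left|right; split=> //]; rewrite ?binders_rapp ?total_rapp; try lia.
  by move=> c; rewrite !nprice_rapp h4.
- case: IH => [h|[h1 h2 h3 h4]]; [left|right; split=> //];
    rewrite ?binders_rapp ?total_rapp ?msumS; try lia.
  by move=> c; rewrite !nprice_rapp !msumS h4.
- case: IH => [h|[h1 h2 h3 h4]]; [left|right; split=> //]; rewrite ?binders_rmu ?h1 //.
    by rewrite !price_rmu h3 h4.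
  by move=> c; rewrite !nprice_rmu h3 h4.
Qed.

(** * Finiteness of the sums *)

(** Sums are finite sets and [sred] asks for this; the addends of each operation are finitely many
    because a bag has finitely many splittings. *)
Lemma finite_split (B : bag) : finite_set [set p : bag * bag | B = (p.1 `+` p.2)%mset].
Proof.
elim/mset_elim: B => [|v B IH].
  apply: sub_finite_set (finite_set1 ((mset0 : bag), (mset0 : bag))).
  by case=> p q /= /esym/msetD_eq0[-> ->].
pose S := [set p : bag * bag | B = (p.1 `+` p.2)%mset].
apply: (@sub_finite_set _ _ ([set (v +` p.1, p.2)%mset | p in S] `|`
                             [set (p.1, v +` p.2)%mset | p in S])).
  move=> [p q] /= /esym/msetD_eq_cons[] [A [-> eB]]; [left|right].
    by exists (A, q).
  by exists (p, A).
by rewrite finite_setU; split; apply: finite_image.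
Qed.

Lemma bmap_finite (R : bag -> rterm -> rterm -> Prop) B C :
  (forall v, v \in C -> forall B, finite_set [set w | R B v w]) ->
  finite_set [set D | bmap R B C D].
Proof.
elim/mset_elim: C B => [|v C IH] B h.
  by apply: sub_finite_set (finite_set1 (mset0 : bag)) => D /= /bmap_nilP[].
pose S := [set p : bag * bag | B = (p.1 `+` p.2)%mset].
pose G p := [set (w +` D)%mset | w in [set w | R p.1 v w] & D in [set D | bmap R p.2 C D]].
apply: (@sub_finite_set _ _ (\bigcup_(p in S) G p)).
  move=> D /= /bmap_consP[B1 [B2 [w [D' [eB -> hw hD]]]]].
  by exists (B1, B2) => //; exists w => //; exists D'.
apply: bigcup_finite; first exact: finite_split.
move=> p _; apply: finite_image2; first by apply: h; rewrite mset1D1.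
by apply: IH => x xC; apply: h; rewrite mset1Dr.
Qed.

Lemma gnamed_finite_of K t : (forall B, finite_set [set u | gsub K B t u]) ->
  forall B b, finite_set [set u | gnamed K B b t u].
Proof.
move=> IH B b; pose S := [set p : bag * bag | B = (p.1 `+` p.2)%mset].
pose G p := [set rapp u p.2 | u in [set u | gsub K p.1 t u]].
apply: (@sub_finite_set _ _ ([set u | gsub K B t u] `|` (\bigcup_(p in S) G p))).
  move=> u [[_ h]|[_ [B1 [B2 [u1 [eB h ->]]]]]]; [by left|right].
  by exists (B1, B2) => //; exists u1.
rewrite finite_setU; split=> //; apply: bigcup_finite; first exact: finite_split.
by move=> p _; apply: finite_image.
Qed.

Lemma gsub_finite K B t : finite_set [set u | gsub K B t u].
Proof.
elim/rterm_ind': t K B => [i|t IH|t C IH IHC|b t IH] K B.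
- case: (mset_0Vmem B) => [->|[v vB]].
    (* One candidate for each kind: [rvar i] for a name, the lowered index for a variable. The 0 is
       a dummy value. *)
    apply: (@sub_finite_set _ _ [set rvar i; rvar (unbump (if K is KV k then k else 0) i)]).
      move=> u /= /gsub_rvar; case: K => [k [[_ e]|[_ _ ->]]|a [_ ->]]; [|by right|by left].
      by have := mset11 u; rewrite -e in_mset0.
    exact: finite_set2.
  apply: (@sub_finite_set _ _ [set v]); last exact: finite_set1.
  move=> u /= /gsub_rvar; case: K => [k [[_ e]|[_ e _]]|a [e _]]; move: vB; rewrite e ?in_mset0 //.
  by rewrite in_mset1 => /eqP ->.
- apply: (@sub_finite_set _ _ [set rlam u | u in [set u | gsub (upv K) (vshift B) t u]]).
    by move=> u /= /gsub_rlam[u' h ->]; exists u'.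
  exact: finite_image.
- pose S := [set p : bag * bag | B = (p.1 `+` p.2)%mset].
  pose G p := [set rapp u D | u in [set u | gsub K p.1 t u] & D in [set D | bmap (gsub K) p.2 C D]].
  apply: (@sub_finite_set _ _ (\bigcup_(p in S) G p)).
    move=> u /= /gsub_rapp[B0 [B1 [t' [D [eB h0 h1 ->]]]]].
    by exists (B0, B1) => //; exists t' => //; exists D.
  apply: bigcup_finite; first exact: finite_split.
  by move=> p _; apply: finite_image2 => //; apply: bmap_finite => v vC B'; apply: IHC.
- apply: (@sub_finite_set _ _ [set rmu b u | u in [set u | gnamed (upn K) (nshift B) b t u]]).
    by move=> u /= /gsub_rmu[u' h ->]; exists u'.
  exact/finite_image/gnamed_finite_of.
Qed.

Lemma rred_finite t T : rred t T -> finite_set T.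
Proof.
elim=> {t T} [t B|b t B|a b t|t T _ IH|t T B _ IH|t v V B _ IH|b t T _ IH];
  try exact: finite_image; [exact: (@gsub_finite (KV 0))| |exact: finite_set1].
apply: (@sub_finite_set _ _ [set rmu b u | u in [set u | gnamed (KN 0) (nshift B) b t u]]).
  by move=> _ [[c u] /napp_namedE[-> h] <-]; exists u.
by apply/finite_image/gnamed_finite_of => B'; apply: gsub_finite.
Qed.

(** * Normal forms as endpoints of reduction paths *)

Lemma sred_at X t T : finite_set X -> X t -> rred t T -> sred X (T `|` (X `\ t)).
Proof.
move=> fX Xt h; exists t, T, (X `\ t); split=> //.
- exact: finite_setD.
- by case=> _; apply.
- by rewrite setD1K.
Qed.

Lemma sred_finite X Y : sred X Y -> finite_set Y.
Proof. by move=> [t [T [S [fS _ /rred_finite fT _ ->]]]]; rewrite finite_setU. Qed.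

Lemma sreds_finite X Y : finite_set X -> sreds X Y -> finite_set Y.
Proof. by move=> f h; elim: h f => [? ? /sred_finite //|//|? ? ? _ h1 _ h2 /h1/h2]. Qed.

Lemma sreds_steps X Y : sreds X Y -> forall u, Y u -> exists2 t, X t & steps t u.
Proof.
elim=> {X Y} [X Y [t [T [S [_ _ h -> ->]]]] u|X u|X Y Z _ IH1 _ IH2 u].
- case=> [Tu|Su]; last by exists u; [right|exact: steps_refl].
  by exists t; [left|apply/steps1/stepP; exists T].
- by exists u => //; apply: steps_refl.
- by move=> /IH2[y /IH1[x Xx s1] s2]; exists x => //; apply: steps_trans s1 s2.
Qed.

Lemma steps_sreds t u X : steps t u -> finite_set X -> X t -> exists2 Y, sreds X Y & Y u.
Proof.
move=> h; elim: h X => {t u} [t|t u v /stepP[T hT Tu] _ IH] X fX Xt.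
  by exists X => //; apply: rt_refl.
have s := sred_at fX Xt hT; have [|Y h Yv] := IH _ (sred_finite s); first by left.
by exists Y => //; apply: rt_trans h; apply: rt_step.
Qed.

(** The middle clause can be met since [sred] replaces only an addend that has a redex: a normal
    addend, once present, stays. *)
Definition normalises X := exists Y,
  [/\ sreds X Y, forall u, X u -> normal u -> Y u & forall u, Y u -> normal u].

Definition bounded_by l m (s : seq rterm) := forall x, x \in s -> ~ normal x ->
  binders x < l \/ (binders x = l /\ total x < m).

(** A multiset-order argument: an addend of the greatest measure allowed, [l] binders and total [m],
    is replaced by finitely many smaller ones. The inner induction counts such addends, the outer
    one is on [m]. *)
Lemma normalises_total l : (forall s, bounded_by l 0 s -> normalises [set` s]) ->
  forall m s, bounded_by l m s -> normalises [set` s].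
Proof.
move=> base; elim=> [|m IHm] //.
pose top := [pred x | `[< ~ normal x >] && (binders x == l) && (total x == m)].
suff H n s : count top s <= n -> bounded_by l m.+1 s -> normalises [set` s].
  by move=> s; apply: H (leqnn _).
elim: n s => [|n IHn] s hc hs.
  apply: IHm => x xs nx; case: (hs x xs nx) => [|[e1 e2]]; [by left|right; split=> //].
  move: hc; rewrite leqn0 -leqn0 leqNgt -has_count => /hasPn/(_ x xs) /=.
  by rewrite e1 eqxx andbT asboolT //= => /eqP; lia.
case: (boolP (has top s)) => [/hasP[t ts]|]; last first.
  by rewrite has_count -leqNgt => h0; apply: IHn => //; lia.
case/andP=> /andP[/asboolP nt /eqP bt] /eqP tt.
have [T hT] : exists T, rred t T.
  by apply/not_existsP => h; apply: nt => T /h.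
have [sT eT] := (finite_seqP T).1 (rred_finite hT).
(* Every copy of [t] goes, since the list may repeat an addend of the set. *)
pose s' := sT ++ [seq x <- s | x != t].
have small x : x \in sT -> binders x < l \/ (binders x = l /\ total x < m).
  move=> xT; have /step_decr : step t x by apply/stepP; exists T => //; rewrite eT.
  by rewrite bt tt; case=> [|[]]; [left|right].
have es : T `|` ([set` s] `\ t) = [set` s'].
  rewrite eT; apply/seteqP; split=> x /=; rewrite mem_cat mem_filter.
    by case=> [->//|[xs /eqP nx]]; rewrite xs nx orbT.
  by case/orP=> [|/andP[/eqP nx xs]]; [left|right].
have sr : sred [set` s] [set` s'] by rewrite -es; apply: sred_at => //; exact: finite_seq.
have [||Y [hY1 hY2 hY3]] := IHn s'.
- rewrite count_cat.
  have -> : count top sT = 0.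
    apply/eqP; rewrite -leqn0 leqNgt -has_count; apply/hasPn => x /small h.
    by apply/negP => /andP[/andP[_ /eqP e1] /eqP e2]; lia.
  have : count top [seq x <- s | x != t] < count top s.
    have /permPl/permP/(_ top) := perm_filterC (fun x => x != t) s; rewrite count_cat => <-.
    rewrite -[X in X < _]addn0 ltn_add2l -has_count; apply/hasP; exists t.
      by rewrite mem_filter /= eqxx.
    by rewrite /= asboolT // bt tt !eqxx.
  lia.
- move=> x; rewrite mem_cat mem_filter => /orP[/small h|/andP[_]]; last exact: hs.
  by move=> _; lia.
exists Y; split=> //; first by apply: rt_trans hY1; apply: rt_step.
move=> u us nu; apply: hY2 => //=; rewrite mem_cat mem_filter us andbT.
by apply/orP; right; apply/eqP => e; apply: nt; rewrite -e.
Qed.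

Lemma normalises_bounded l m s : bounded_by l m s -> normalises [set` s].
Proof.
elim: l m s => [|l IHl] m; apply: normalises_total => {m} s hs.
  exists [set` s]; split=> // [|u us]; first exact: rt_refl.
  by apply: contrapT => /(hs u us)[|[]].
(* All non-normal addends have at most [l] binders, so any strict bound on their totals is a start
   for level [l]. *)
apply: (IHl (\max_(x <- s) total x).+1) => x xs nx.
case: (hs x xs nx) => [|[]//]; rewrite ltnS leq_eqVlt => /orP[/eqP e|]; [right|by left].
by split=> //; rewrite ltnS leq_bigmax_seq.
Qed.

Lemma finite_normalises X : finite_set X -> normalises X.
Proof.
move=> /finite_seqP[s ->]; apply: (@normalises_bounded (\max_(x <- s) binders x).+1 0) => x xs _.
by left; rewrite ltnS leq_bigmax_seq.
Qed.

(** Given a path to [u], follow it inside sums until [u] is an addend, then normalise the remaining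
    addends; [u] is kept because it is normal. *)
Lemma nf_rP t u : nf_r t u <-> normal u /\ steps t u.
Proof.
split=> [[S [hS nS] Su]|[nu h]].
  have fS := sreds_finite (finite_set1 t) hS; split.
    by move=> T hT; apply: nS (sred_at fS Su hT).
  by have [_ -> s] := sreds_steps hS Su.
have [X hX Xu] := steps_sreds h (finite_set1 t) erefl.
have [Y [h1 h2 h3]] := finite_normalises (sreds_finite (finite_set1 t) hX).
exists Y; last exact: h2; split; first exact: rt_trans hX h1.
move=> S' [v [T [S [_ _ hT eY _]]]]; have : Y v by rewrite eY; left.
by move=> /h3/(_ T).
Qed.

Lemma NF_taylor M : NF (taylor M) = Nf M.
Proof.
apply/seteqP; split=> u; first by move=> [t ht /nf_rP[nu s]]; split=> //; exists t.
by move=> [nu [t ht s]]; exists t => //; apply/nf_rP.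
Qed.

(** * Parallel substitution *)

Lemma eq_lren f f' g g' : f =1 f' -> g =1 g' -> lren f g =1 lren f' g'.
Proof.
move=> ef eg M; elim: M f f' g g' ef eg => [i|M IH|M IHM N IHN|b M IH] f f' g g' ef eg /=.
- by rewrite ef.
- by rewrite (IH _ _ _ _ (eq_up ef) eg).
- by rewrite (IHM _ _ _ _ ef eg) (IHN _ _ _ _ ef eg).
- by rewrite (eq_up eg) (IH _ _ _ _ ef (eq_up eg)).
Qed.

Lemma lren_comp f f' g g' M : lren f g (lren f' g' M) = lren (f \o f') (g \o g') M.
Proof.
elim: M f f' g g' => [i|M IH|M IHM N IHN|b M IH] f f' g g' //=.
- by rewrite IH (eq_lren (up_comp _ _) (frefl _)).
- by rewrite IHM IHN.
- by rewrite IH (eq_lren (frefl _) (up_comp _ _)) -up_comp.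
Qed.

Lemma lren_id M : lren id id M = M.
Proof.
elim: M => [i|M IH|M IHM N IHN|b M IH] //=.
- by rewrite (eq_lren up_id (frefl _)) IH.
- by rewrite IHM IHN.
- by rewrite (eq_lren (frefl _) up_id) IH up_id.
Qed.

Definition scons T (x : T) (s : nat -> T) (i : nat) : T := if i is j.+1 then s j else x.
Definition ups (s : nat -> lterm) := scons (Var 0) (lren S id \o s).
Definition nups (s : nat -> lterm) := lren id S \o s.

Fixpoint lsub (s : nat -> lterm) (M : lterm) : lterm :=
  match M with
  | Var i => s i
  | Lam M => Lam (lsub (ups s) M)
  | App M N => App (lsub s M) (lsub s N)
  | Mu b M => Mu b (lsub (nups s) M)
  end.

Lemma eq_lsub s s' : s =1 s' -> lsub s =1 lsub s'.
Proof.
move=> e M; elim: M s s' e => [i|M IH|M IHM N IHN|b M IH] s s' e /=.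
- exact: e.
- by congr Lam; apply: IH => -[|i] //=; rewrite e.
- by rewrite (IHM _ _ e) (IHN _ _ e).
- by congr Mu; apply: IH => i; rewrite /nups /= e.
Qed.

Lemma lsub_id M : lsub Var M = M.
Proof.
elim: M => [i|M IH|M IHM N IHN|b M IH] //=.
- by rewrite (@eq_lsub _ Var) ?IH // => -[].
- by rewrite IHM IHN.
- by rewrite (@eq_lsub _ Var) ?IH.
Qed.

Lemma lren_lsub f g s M : lren f g (lsub s M) = lsub (lren f g \o s) (lren id g M).
Proof.
elim: M f g s => [i|M IH|M IHM N IHN|b M IH] f g s //=.
- rewrite IH (eq_lren up_id (frefl g)); congr Lam; apply: eq_lsub => -[|i] //=.
  by rewrite !lren_comp.
- by rewrite IHM IHN.
- by rewrite IH; congr Mu; apply: eq_lsub => i; rewrite /nups /= !lren_comp.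
Qed.

Lemma lsub_lren f s M : lsub s (lren f id M) = lsub (s \o f) M.
Proof.
elim: M f s => [i|M IH|M IHM N IHN|b M IH] f s //=.
- by rewrite IH; congr Lam; apply: eq_lsub => -[|i].
- by rewrite IHM IHN.
- by rewrite up_id (eq_lren (frefl f) up_id) IH.
Qed.

Lemma ups_lren s N : lsub (ups s) (lren S id N) = lren S id (lsub s N).
Proof. by rewrite lsub_lren lren_lsub lren_id. Qed.

Lemma nups_lren s N : lsub (nups s) (lren id S N) = lren id S (lsub s N).
Proof. by rewrite lren_lsub. Qed.

Lemma lsub_comp s s' M : lsub s (lsub s' M) = lsub (lsub s \o s') M.
Proof.
elim: M s s' => [i|M IH|M IHM N IHN|b M IH] s s' //=.
- by rewrite IH; congr Lam; apply: eq_lsub => -[|i] //=; rewrite ups_lren.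
- by rewrite IHM IHN.
- by rewrite IH; congr Mu; apply: eq_lsub => i; rewrite /nups /= lren_lsub.
Qed.

Definition sub1 k N i := if i == k then N else Var (unbump k i).

Lemma lgsub_sub1 k N M : lgsub (KV k) N M = lsub (sub1 k N) M.
Proof.
elim: M k N => [i|M IH|M IHM M' IHM'|b M IH] k N //=.
- rewrite IH; congr Lam; apply: eq_lsub => -[|i] //=.
  by rewrite /sub1 eqSS unbumpSS; case: eqP.
- by rewrite IHM IHM'.
- rewrite IH; congr Mu; apply: eq_lsub => i.
  by rewrite /nups /sub1 /=; case: eqP.
Qed.

Lemma lgsub_scons N s M : lgsub (KV 0) N (lsub (ups s) M) = lsub (scons N s) M.
Proof.
rewrite lgsub_sub1 lsub_comp; apply: eq_lsub => -[|i] //=.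
rewrite lsub_lren -[RHS]lsub_id; apply: eq_lsub => j.
by rewrite /sub1 /= /unbump /= subn1.
Qed.

Lemma lsub_beta s N M : lsub s (lgsub (KV 0) N M) = lgsub (KV 0) (lsub s N) (lsub (ups s) M).
Proof.
rewrite lgsub_scons lgsub_sub1 lsub_comp; apply: eq_lsub => -[|i] //=.
by rewrite /unbump /= subn1.
Qed.

Lemma lsub_lnamed s K N b M : lsub s (lnamed K N b M) = lnamed K (lsub s N) b (lsub s M).
Proof. by case: K => //= a; case: eqP. Qed.

Lemma lgsub_lren_fresh a N f g M : (forall b, g b <> a) -> lgsub (KN a) N (lren f g M) = lren f g M.
Proof.
elim: M a N f g => [i|M IH|M IHM M' IHM'|b M IH] a N f g h //=.
- by rewrite IH.
- by rewrite IHM // IHM'.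
- have h' c : up g c <> a.+1 by case: c => //= c [] /h.
  by rewrite IH //; case: eqP => // e; case: (h' b).
Qed.

(** The factorisation through [g] says that [a] does not occur in the terms of [s], in a form that
    passes below binders. *)
Lemma lsub_lnapp a N M s t g : s =1 lren id g \o t -> (forall b, g b <> a) ->
  lsub s (lgsub (KN a) N M) = lgsub (KN a) (lsub s N) (lsub s M).
Proof.
elim: M a N s t g => [i|M IH|M IHM M' IHM'|b M IH] a N s t g e h //=.
- by rewrite e /= lgsub_lren_fresh.
- rewrite -ups_lren; congr Lam; apply: (IH _ _ _ (ups t) g) => // -[|i] //=.
  by rewrite e /= !lren_comp.
- by rewrite (IHM _ _ _ t g) // (IHM' _ _ _ t g).
- rewrite -nups_lren -[if _ then _ else _]/(lnamed (KN a.+1) _ b _) lsub_lnamed /=.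
  rewrite (IH _ _ _ t (S \o g)) //; last by move=> c [] /h.
  by move=> i; rewrite /nups /= e /= lren_comp.
Qed.

Lemma lhapp_lsub s M M' : lhapp M M' -> lhapp (lsub s M) (lsub s M').
Proof.
elim=> {M M'} [M N|b M N|P P' N _ IH] /=.
- by rewrite lsub_beta; apply: lhapp_lam.
- rewrite -[if _ then _ else _]/(lnamed (KN 0) _ b _) lsub_lnamed.
  rewrite (@lsub_lnapp _ _ _ _ s S) // nups_lren; exact: lhapp_mu.
- exact: lhapp_app.
Qed.

(** A head redex is made of constructors that substitution leaves in place. *)
Lemma lhst_lsub s M M' : lhst M M' -> lhst (lsub s M) (lsub s M').
Proof.
case=> {M M'} [M M' h|a b M|a P P' h] /=.
- exact/lhst_app/lhapp_lsub.
- have -> : lsub (nups s) (lren id (ninst a) M) = lren id (ninst a) (lsub (nups (nups s)) M).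
    by rewrite lren_lsub; apply: eq_lsub => i; rewrite /nups /= !lren_comp.
  exact: lhst_rho.
- exact/lhst_mu/lhapp_lsub.
Qed.

Inductive lhapps : lterm -> lterm -> Prop :=
| lhapps_refl M : lhapps M M
| lhapps_cons M M' M'' : lhapp M M' -> lhapps M' M'' -> lhapps M M''.

Inductive lhsts : lterm -> lterm -> Prop :=
| lhsts_refl M : lhsts M M
| lhsts_cons M M' M'' : lhst M M' -> lhsts M' M'' -> lhsts M M''.

Lemma lhapps1 M M' : lhapp M M' -> lhapps M M'.
Proof. by move=> h; apply: lhapps_cons h (lhapps_refl _). Qed.

Lemma lhapps_trans M M' M'' : lhapps M M' -> lhapps M' M'' -> lhapps M M''.
Proof. by elim=> // X Y Z h _ IH /IH; apply: lhapps_cons. Qed.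

Lemma lhapps_app P P' N : lhapps P P' -> lhapps (App P N) (App P' N).
Proof.
by elim=> [M|X Y Z h _]; [exact: lhapps_refl|apply: lhapps_cons; apply: lhapp_app].
Qed.

Lemma Nf_lhapps M M' : lhapps M M' -> Nf M = Nf M'.
Proof. by elim=> // X Y Z h _ <-; apply/Nf_lhst/lhst_app. Qed.

Lemma Nf_lhapps_mu b M M' : lhapps M M' -> Nf (Mu b M) = Nf (Mu b M').
Proof. by elim=> // X Y Z h _ <-; apply/Nf_lhst/lhst_mu. Qed.

Lemma Nf_lsub_lhsts s M M' : lhsts M M' -> Nf (lsub s M) = Nf (lsub s M').
Proof. by elim=> // X Y Z h _ <-; apply/Nf_lhst/lhst_lsub. Qed.

(** * Weak head normal forms *)

(** The index counts the arguments, hence the abstractions that a constant function needs to discard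
    them. *)
Inductive spine (x : nat) : nat -> lterm -> Prop :=
| spine_var : spine x 0 (Var x)
| spine_app k P N : spine x k P -> spine x k.+1 (App P N).

Variant whnf : lterm -> Prop :=
| whnf_lam M : whnf (Lam M)
| whnf_spine x k M : spine x k M -> whnf M
| whnf_mu_lam b M : whnf (Mu b (Lam M))
| whnf_mu_spine b x k M : spine x k M -> whnf (Mu b M).

Lemma app_spine P N : (exists M, lhapp (App P N) M) \/ exists x k, spine x k (App P N).
Proof.
elim: P N => [i|M _|P IH Q _|b M _] N.
- by right; exists i, 1; apply/spine_app/spine_var.
- by left; eexists; apply: lhapp_lam.
- case: (IH Q) => [[M h]|[x [k h]]]; first by left; eexists; apply: lhapp_app h.
  by right; exists x, k.+1; apply: spine_app.
- by left; eexists; apply: lhapp_mu.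
Qed.

Lemma lhst_or_whnf M : (exists M', lhst M M') \/ whnf M.
Proof.
case: M => [i|M|P Q|b [i|M|P Q|c M]].
- by right; apply: (whnf_spine (spine_var i)).
- by right; apply: whnf_lam.
- case: (app_spine P Q) => [[M h]|[x [k h]]]; first by left; exists M; apply: lhst_app.
  by right; apply: whnf_spine h.
- by right; apply: (whnf_mu_spine _ (spine_var i)).
- by right; apply: whnf_mu_lam.
- case: (app_spine P Q) => [[M h]|[x [k h]]]; first by left; exists (Mu b M); apply: lhst_mu.
  by right; apply: whnf_mu_spine h.
- by left; eexists; apply: lhst_rho.
Qed.

Lemma step_acc t : Acc (fun u v => step v u) t.
Proof.
suff H l m s : binders s = l -> total s = m -> Acc (fun u v => step v u) s by exact: H.
elim/ltn_ind: l m s => l IHl m; elim/ltn_ind: m => m IHm s el em.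
constructor=> u /step_decr[h|[h1 h2 _ _]].
  by apply: IHl; [rewrite -el; exact: h|by []|by []].
by apply: IHm; [rewrite -em; exact: h2|rewrite h1|by []].
Qed.

(** Every head step of [M] is an actual step of a resource term that still reduces to [u], so
    well-foundedness of [step] bounds the head reduction of [M]. *)
Lemma Nf_whnf s M u : Nf (lsub s M) u -> exists2 M', lhsts M M' & whnf M'.
Proof.
move=> [nu [t ht st]]; elim: (step_acc t) M ht st => {}t _ IH M ht st.
case: (lhst_or_whnf M) => [[M' h]|]; last by exists M => //; apply: lhsts_refl.
have [h1 h2 _] := taylor_lhst (lhst_lsub s h).
have [t' ht' st'] := hst_first (h1 _ ht) st nu.
have [M'' hM wM] := IH _ (hst_step ht') _ (h2 _ _ ht ht') st'.
by exists M'' => //; apply: lhsts_cons hM.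
Qed.

(** * Reduction and normal forms below a fixed head *)

Inductive vspine : rterm -> Prop :=
| vspine_var i : vspine (rvar i)
| vspine_app p B : vspine p -> vspine (rapp p B).

Lemma vspineP p : vspine p -> (exists i, p = rvar i) \/ exists q B, p = rapp q B /\ vspine q.
Proof. by case=> [i|q B h]; [left; exists i|right; exists q, B]. Qed.

Lemma vspine_rlam t : ~ vspine (rlam t).
Proof. by move/vspineP => [[? ]|[? [? []]]]; rdiscr. Qed.

Lemma vspine_rmu b t : ~ vspine (rmu b t).
Proof. by move/vspineP => [[? ]|[? [? []]]]; rdiscr. Qed.

Lemma vspine_step_rapp p B x : vspine p -> step (rapp p B) x ->
  (exists2 p', step p p' & x = rapp p' B) \/
  (exists v w C, [/\ B = (v +` C)%mset, step v w & x = rapp p (w +` C)%mset]).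
Proof.
move=> vp /step_rapp[[t e]|[b [t [u [e]]]]|h|h]; [| |by left|by right].
  by case: (@vspine_rlam t); rewrite -e.
by case: (@vspine_rmu b t); rewrite -e.
Qed.

Lemma vspine_step t u : vspine t -> step t u -> vspine u.
Proof.
move=> h; elim: h u => [i u /step_rvar //|p B hp IH u].
case/(vspine_step_rapp hp) => [[p' /IH h ->]|[v [w [C [_ _ ->]]]]]; exact: vspine_app.
Qed.

Lemma steps_rlam_inv t x : steps (rlam t) x -> exists2 t', steps t t' & x = rlam t'.
Proof.
move=> h; have [s es] : exists s, s = rlam t by eexists.
rewrite -es in h; elim: h t es => {s x} [s t ->|s u x h _ IH t es].
  by exists t => //; apply: steps_refl.
move: h; rewrite es => /step_rlam[t1 st eu]; have [t' st' ->] := IH _ eu.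
by exists t' => //; apply: steps_cons st st'.
Qed.

(** Terms below which no merge with an outer [mu] can ever arise: the class is closed under
    steps. *)
Definition rigid t := (exists t', t = rlam t') \/ vspine t.

Lemma rigid_rmu b t : ~ rigid (rmu b t).
Proof. by case=> [[t']|/vspine_rmu //]; rdiscr. Qed.

Lemma rigid_step t u : rigid t -> step t u -> rigid u.
Proof.
case=> [[t' ->] /step_rlam[u' _ ->]|h s]; first by left; exists u'.
by right; apply: vspine_step h s.
Qed.

Lemma steps_rmu_inv b t x : rigid t -> steps (rmu b t) x -> exists2 t', steps t t' & x = rmu b t'.
Proof.
move=> rt h; have [s es] : exists s, s = rmu b t by eexists.
rewrite -es in h; elim: h t rt es => {s x} [s t _ ->|s u x h _ IH t rt es].
  by exists t => //; apply: steps_refl.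
move: h; rewrite es => /step_rmu[[t1 st eu]|[c [t1 [e _]]]]; last first.
  by move: rt; rewrite e => /rigid_rmu.
have [t' st' ->] := IH _ (rigid_step rt st) eu.
by exists t' => //; apply: steps_cons st st'.
Qed.

Lemma steps_rapp_inv p B x : vspine p -> steps (rapp p B) x ->
  exists p' B', [/\ steps p p', forall w, w \in B' -> exists2 v, v \in B & steps v w &
                    x = rapp p' B'].
Proof.
move=> vp h; have [s es] : exists s, s = rapp p B by eexists.
rewrite -es in h; elim: h p B vp es => {s x} [s p B _ ->|s u x h _ IH p B vp es].
  exists p, B; split=> // [|w wB]; first exact: steps_refl.
  by exists w => //; apply: steps_refl.
move: h; rewrite es => /(vspine_step_rapp vp)[[p1 st eu]|[v [w [C [eB st eu]]]]].
  have [p' [B' [h1 h2 ->]]] := IH _ _ (vspine_step vp st) eu.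
  by exists p', B'; split=> //; apply: steps_cons st h1.
have [p' [B' [h1 h2 ->]]] := IH _ _ vp eu.
exists p', B'; split=> // y /h2[z]; rewrite in_mset1D => /orP[/eqP ->|zC] sz.
  by exists v; [rewrite eB mset1D1|apply: steps_cons st sz].
by exists z => //; rewrite eB mset1Dr.
Qed.

Lemma rred_inv t T : rred t T ->
  [\/ exists2 t', t = rlam t' & exists T', rred t' T',
      exists b t', t = rmu b t' /\ ((exists T', rred t' T') \/ exists c s, t' = rmu c s) |
      exists p B, t = rapp p B /\ [\/ exists s, p = rlam s, exists b s, p = rmu b s,
        exists T', rred p T' | exists2 v, v \in B & exists T', rred v T']].
Proof.
case=> {t T} [t B|b t B|a b t|t T h|t T B h|t v V B h|b t T h].
- by apply: Or33; exists (rlam t), B; split=> //; apply: Or41; exists t.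
- by apply: Or33; exists (rmu b t), B; split=> //; apply: Or42; exists b, t.
- by apply: Or32; exists a, (rmu b t); split=> //; right; exists b, t.
- by apply: Or31; exists t => //; exists T.
- by apply: Or33; exists t, B; split=> //; apply: Or43; exists T.
- apply: Or33; exists t, (v +` B)%mset; split=> //; apply: Or44; exists v; rewrite ?mset1D1 //.
  by exists V.
- by apply: Or32; exists b, t; split=> //; left; exists T.
Qed.

Lemma normal_rvar i : normal (rvar i).
Proof. by move=> T /rred_inv[[?]|[? [? []]]|[? [? []]]]; rdiscr. Qed.

Lemma normal_rlam t : normal (rlam t) <-> normal t.
Proof.
split=> h T hT; first by apply: h (rred_ctx_lam hT).
case/rred_inv: hT => [[t' /rlam_inj <- [T' /h //]]|[? [? []]]|[? [? []]]]; rdiscr.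
Qed.

Lemma normal_rmu b t : rigid t -> normal (rmu b t) <-> normal t.
Proof.
move=> rt; split=> h T hT; first by apply: h (rred_ctx_mu b hT).
case/rred_inv: hT => [[t']|[? [? [/rmu_inj[_ <-] [[T' /h //]|[c [s e]]]]]]|[? [? []]]]; try rdiscr.
by move: rt; rewrite e => /rigid_rmu.
Qed.

Lemma normal_rapp p B : vspine p -> normal (rapp p B) <-> normal p /\ bag_in normal B.
Proof.
move=> vp; split=> [h|[h1 h2] T hT].
  split=> [T hT|v vB T hT]; first by apply: h (rred_ctx_appl B hT).
  have [C eB] := mset_mem_cons vB; rewrite eB in h.
  by apply: h (rred_ctx_appr p C hT).
case/rred_inv: hT => [[t']|[? [? []]]|[? [? [/rapp_inj[<- <-]]]]]; try rdiscr.
case=> [[s e]|[b [s e]]|[T' /h1 //]|[v /h2 nv [T' /nv //]]].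
  by move: vp; rewrite e => /vspine_rlam.
by move: vp; rewrite e => /vspine_rmu.
Qed.

Lemma spine_taylor x k M t : spine x k M -> taylor M t -> vspine t.
Proof.
move=> h; elim: h t => {k M} [t ->|k P N _ IH _ /taylor_app[p [B [/IH h _ ->]]]].
  exact: vspine_var.
exact: vspine_app.
Qed.

Lemma vspine_steps t u : vspine t -> steps t u -> vspine u.
Proof. by move=> h s; elim: s h => // x y z s _ IH /vspine_step/(_ s). Qed.

Lemma Nf_lam M u : Nf (Lam M) u <-> exists2 v, Nf M v & u = rlam v.
Proof.
split=> [[nu [_ [t ht <-] /steps_rlam_inv[v st e]]]|[v [nv [t ht st]] ->]].
  exists v => //; split; last by exists t.
  by apply/normal_rlam; rewrite -e.
by split; [apply/normal_rlam|exists (rlam t); [exists t|apply: steps_rlam]].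
Qed.

Lemma rigid_steps t u : rigid t -> steps t u -> rigid u.
Proof. by move=> h s; elim: s h => // x y z s _ IH /rigid_step/(_ s). Qed.

Lemma Nf_mu b M u : (forall t, taylor M t -> rigid t) ->
  Nf (Mu b M) u <-> exists2 v, Nf M v & u = rmu b v.
Proof.
move=> rM; split=> [[nu [_ [t ht <-]]]|[v [nv [t ht st]] ->]].
  have rt := rM _ ht; move=> /(steps_rmu_inv rt)[v st e].
  exists v => //; split; last by exists t.
  by apply/(normal_rmu b (rigid_steps rt st)); rewrite -e.
have rv := rigid_steps (rM _ ht) st.
by split; [apply/(normal_rmu b rv)|exists (rmu b t); [exists t|apply: steps_rmu]].
Qed.

(** Below a head variable each step acts in the function or in one element of the bag, so a path
    splits into independent paths. *)
Lemma Nf_app x k P N u : spine x k P ->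
  Nf (App P N) u <-> exists p D, [/\ Nf P p, bag_in (Nf N) D & u = rapp p D].
Proof.
move=> sP; split=> [[nu [_ /taylor_app[t [B [ht hB ->]]]]]|[p [D [[np [t ht st]] hD ->]]]].
  have vt := spine_taylor sP ht; move=> /(steps_rapp_inv vt)[p [D [st hD e]]].
  move: nu; rewrite e => /(normal_rapp _ (vspine_steps vt st))[np nD].
  exists p, D; split=> //; first by split=> //; exists t.
  by move=> w wD; split; [exact: nD|have [v /hB hv s] := hD _ wD; exists v].
have vt := spine_taylor sP ht; split.
  by apply/(normal_rapp _ (vspine_steps vt st)); split=> // v /hD[].
(* [E] holds the elements that are already reduced while the others are treated in turn. *)
suff [B hB sB] : exists2 B, bag_in (taylor N) B &
    forall E, steps (rapp p (B `+` E)%mset) (rapp p (D `+` E)%mset).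
  exists (rapp t B); first by apply/taylor_app; exists t, B.
  by apply: steps_trans (steps_rappl B st) _; have := sB mset0; rewrite !msetD0.
elim/mset_elim: D hD => [_|v D IH /bag_inS[[_ [w hw sw]] /IH[B hB sB]]].
  by exists mset0; [exact: bag_in0|move=> E; exact: steps_refl].
exists (w +` B)%mset; first exact/bag_inS.
move=> E; rewrite -!msetDA; apply: steps_trans (steps_rappr _ _ sw) _.
by rewrite !(msetDCA [mset v]%mset); apply: sB.
Qed.

Lemma Nf_spine_neq0 x k P : spine x k P -> exists p, Nf P p.
Proof.
elim=> {k P} [|k P N sP [p hp]].
  exists (rvar x); split; first exact: normal_rvar.
  by exists (rvar x) => //; apply: steps_refl.
exists (rapp p mset0); apply/(Nf_app _ _ sP); exists p, mset0; split=> //; exact: bag_in0.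
Qed.

(** * Perpendicular lines *)

(** Closedness of [C] is expressed by invariance under renaming and substitution, the form in which
    it is used. *)
Lemma lams_closed C : (forall f g, lren f g C = C) -> (forall k N, lgsub (KV k) N C = C) ->
  forall m, (forall f g, lren f g (lams m C) = lams m C) /\
            (forall k N, lgsub (KV k) N (lams m C) = lams m C).
Proof. by move=> h1 h2; elim=> [|m [IH1 IH2]] //=; split=> *; rewrite ?IH1 ?IH2. Qed.

(** Each argument on the spine removes one abstraction; [m] of them are left at the end. *)
Lemma spine_absorb C x k M s :
  (forall f g, lren f g C = C) -> (forall k N, lgsub (KV k) N C = C) ->
  spine x k M -> forall m, s x = lams (k + m) C -> lhapps (lsub s M) (lams m C).
Proof.
move=> h1 h2; elim=> {k M} [m /= ->|k P N _ IH m e]; first exact: lhapps_refl.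
apply: lhapps_trans (lhapps_app _ (IH m.+1 _)) _; first by rewrite e addnS.
by apply: lhapps1; rewrite -((lams_closed h1 h2 m).2 0 (lsub s N)); apply: lhapp_lam.
Qed.

(** The shape of [u] is dictated by the head of [F] and known only after reducing [F]; hence
    induction hypotheses guarded by equations. *)
Lemma rterm_sub_ind (P : rterm -> Prop) :
  (forall u, (forall v, u = rlam v -> P v) -> (forall b v, u = rmu b v -> P v) ->
     (forall p B, u = rapp p B -> P p /\ bag_in P B) -> P u) ->
  forall u, P u.
Proof.
move=> H; elim/rterm_ind' => [i|t IH|t B IH IHB|b t IH]; apply: H => *.
all: try by match goal with e : _ = _ |- _ => move: e end; rdiscr.
- by match goal with e : _ = _ |- _ => move/rlam_inj: e => <- end.
- by match goal with e : _ = _ |- _ => move/rapp_inj: e => [<- <-] end.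
- by match goal with e : _ = _ |- _ => move/rmu_inj: e => [_ <-] end.
Qed.

Section Perpendicular.
Variables (I : eqType) (M : I -> I -> lterm).

Definition line (i : I) (Z : lterm) (j : I) : lterm := if j == i then Z else M i j.

(** [q] tells which variables stand for which [z_j]; the terms put for the [z_j]
    are renamed by [f] and [g] when the substitution has crossed binders. *)
Definition env (q : nat -> I + nat) f g (Z : I -> lterm) (i : nat) : lterm :=
  match q i with inl j => lren f g (Z j) | inr m => Var m end.

Definition upq (q : nat -> I + nat) : nat -> I + nat :=
  scons (inr 0) (fun i => match q i with inl j => inl j | inr m => inr m.+1 end).

Lemma ups_env q f g Z : ups (env q f g Z) =1 env (upq q) (S \o f) g Z.
Proof. by move=> [|i] //=; rewrite /env /=; case: (q i) => // j; rewrite lren_comp. Qed.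

Lemma nups_env q f g Z : nups (env q f g Z) =1 env q f (S \o g) Z.
Proof. by move=> i; rewrite /nups /env /=; case: (q i) => // j; rewrite lren_comp. Qed.

(** The common value on a line is left implicit, so that the property can pass to arguments of the
    head, for which no such term is given. *)
Definition line_const F q f g := forall i Z Z',
  Nf (lsub (env q f g (line i Z)) F) = Nf (lsub (env q f g (line i Z')) F).

Lemma spine_env q f g Z x m k P : spine x k P -> q x = inr m -> spine m k (lsub (env q f g Z) P).
Proof.
move=> h qx; elim: h => {k P} [|k P N _ IH]; last exact: spine_app.
by rewrite /= /env qx; apply: spine_var.
Qed.

(* Putting a constant function of enough arguments for the head variable
   discards everything else, so the line depends on the chosen constant. *)
Lemma spine_not_const q f g x k P i (ctx : lterm -> lterm) : spine x k P -> q x = inl i ->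
  (forall N N', lhapps N N' -> Nf (ctx N) = Nf (ctx N')) ->
  (forall Z Z', Nf (ctx (lsub (env q f g (line i Z)) P)) = Nf (ctx (lsub (env q f g (line i Z')) P))) ->
  Nf (ctx (Lam (Var 0))) = Nf (ctx (Lam (Lam (Var 0)))).
Proof.
move=> sP qx hctx hc.
have absorb C : (forall f g, lren f g C = C) -> (forall k N, lgsub (KV k) N C = C) ->
    lhapps (lsub (env q f g (line i (lams k C))) P) C.
  move=> h1 h2; apply: (spine_absorb h1 h2 sP (m := 0)).
  by rewrite addn0 /env qx /line eqxx (lams_closed h1 h2 k).1.
rewrite -(hctx _ _ (absorb (Lam (Var 0)) _ _)) // -(hctx _ _ (absorb (Lam (Lam (Var 0))) _ _)) //.
Qed.

Lemma Nf_var m : Nf (Var m) (rvar m).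
Proof. by split; [exact: normal_rvar|exists (rvar m) => //; apply: steps_refl]. Qed.

Lemma Nf_id_neq : Nf (Lam (Var 0)) <> Nf (Lam (Lam (Var 0))).
Proof.
move=> e; have : Nf (Lam (Var 0)) (rlam (rvar 0)) by apply/Nf_lam; exists (rvar 0); [exact: Nf_var|].
rewrite e => /Nf_lam[v /Nf_lam[w _ ->] /rlam_inj]; rdiscr.
Qed.

Lemma taylor_lam_rigid F t : taylor (Lam F) t -> rigid t.
Proof. by move=> [t' _ <-]; left; exists t'. Qed.

Lemma Nf_lam_inj A B : Nf (Lam A) = Nf (Lam B) -> Nf A = Nf B.
Proof.
move=> e; apply/seteqP; split=> w hw.
  have : Nf (Lam A) (rlam w) by apply/Nf_lam; exists w.
  by rewrite e => /Nf_lam[v hv /rlam_inj ->].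
have : Nf (Lam B) (rlam w) by apply/Nf_lam; exists w.
by rewrite -e => /Nf_lam[v hv /rlam_inj ->].
Qed.

Lemma Nf_mu_inj b A B : (forall t, taylor A t -> rigid t) -> (forall t, taylor B t -> rigid t) ->
  Nf (Mu b A) = Nf (Mu b B) -> Nf A = Nf B.
Proof.
move=> rA rB e; apply/seteqP; split=> w hw.
  have : Nf (Mu b A) (rmu b w) by apply/(Nf_mu b _ rA); exists w.
  by rewrite e => /(Nf_mu b _ rB)[v hv /rmu_inj[_ ->]].
have : Nf (Mu b B) (rmu b w) by apply/(Nf_mu b _ rB); exists w.
by rewrite -e => /(Nf_mu b _ rA)[v hv /rmu_inj[_ ->]].
Qed.

(** The function part is read off from terms with an empty bag, the argument from terms with a
    singleton bag; the latter needs some normal form of the function. *)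
Lemma Nf_app_inj x k P Q y l P' Q' : spine x k P -> spine y l P' ->
  Nf (App P Q) = Nf (App P' Q') -> Nf P = Nf P' /\ Nf Q = Nf Q'.
Proof.
suff sub x1 k1 P1 Q1 x2 k2 P2 Q2 : spine x1 k1 P1 -> spine x2 k2 P2 ->
    Nf (App P1 Q1) = Nf (App P2 Q2) -> Nf P1 `<=` Nf P2 /\ Nf Q1 `<=` Nf Q2.
  move=> s1 s2 e; have [h1 h2] := sub _ _ _ _ _ _ _ _ s1 s2 e.
  by have [h3 h4] := sub _ _ _ _ _ _ _ _ s2 s1 (esym e); split; apply/seteqP.
move=> s1 s2 e; split=> [p hp|v hv].
  have : Nf (App P1 Q1) (rapp p mset0).
    by apply/(Nf_app _ _ s1); exists p, mset0; split=> //; apply: bag_in0.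
  by rewrite e => /(Nf_app _ _ s2)[p' [D [hp' _ /rapp_inj[-> _]]]].
have [p hp] := Nf_spine_neq0 s1.
have : Nf (App P1 Q1) (rapp p [mset v]%mset).
  by apply/(Nf_app _ _ s1); exists p, [mset v]%mset; split=> //; apply: bag_in1.
rewrite e => /(Nf_app _ _ s2)[p' [D [_ hD /rapp_inj[_ eD]]]].
by apply: hD; rewrite -eD mset11.
Qed.

(** An implication for a single [u] makes induction on [u] possible; exchanging [Z] and [Z'] gives
    equality. The environment is general because the recursion goes below binders. *)
Lemma line_const_const u F q f g : line_const F q f g -> forall Z Z',
  Nf (lsub (env q f g Z) F) u -> Nf (lsub (env q f g Z') F) u.
Proof.
elim/rterm_sub_ind: u F q f g => u IHl IHm IHa F q f g hF Z Z' hu.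
have [F' hh wF] := Nf_whnf hu.
have eN s := Nf_lsub_lhsts s hh.
have {}hF : line_const F' q f g by move=> i Y Y'; rewrite -!eN; apply: hF.
move: hF hu; rewrite !eN {F hh eN}.
have mu_case b G : (forall Y t, taylor (lsub (env q f (S \o g) Y) G) t -> rigid t) ->
    line_const (Mu b G) q f g ->
    Nf (lsub (env q f g Z) (Mu b G)) u -> Nf (lsub (env q f g Z') (Mu b G)) u.
  move=> rG hG; rewrite /= !(eq_lsub (nups_env q f g _)).
  move=> /(Nf_mu b u (rG _))[v hv eu]; apply/(Nf_mu b u (rG _)); exists v => //.
  apply: (IHm _ _ eu) hv => i Y Y'.
  have := hG i Y Y'; rewrite /= !(eq_lsub (nups_env q f g _)) => e.
  exact: Nf_mu_inj (rG _) (rG _) e.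
case: wF => {F'} [G|x k G sG|b G|b x k G sG] hG.
- rewrite /= !(eq_lsub (ups_env q f g _)) => /Nf_lam[v hv eu]; apply/Nf_lam; exists v => //.
  apply: (IHl _ eu) hv => i Y Y'.
  by have := hG i Y Y'; rewrite /= !(eq_lsub (ups_env q f g _)) => /Nf_lam_inj.
- case qx : (q x) => [i|m].
    by case: Nf_id_neq; apply: (spine_not_const (ctx := id) sG qx (@Nf_lhapps)) => Y Y'; apply: hG.
  case: sG hG => {k G} [|k P N sP] hG /=; first by rewrite /env qx.
  have sE Y := spine_env f g Y sP qx.
  move=> /(Nf_app _ _ (sE _))[p [D [hp hD eu]]]; apply/(Nf_app _ _ (sE _)).
  (* Whatever fills the environment, the head is the variable [m], so constancy on lines passes to
     function and argument separately. *)
  have hPN i Y Y' := Nf_app_inj (sE _) (sE _) (hG i Y Y').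
  have [IHp IHD] := IHa _ _ eu; exists p, D; split=> //.
    by apply: IHp hp => i Y Y'; have [] := hPN i Y Y'.
  by move=> v vD; apply: IHD (hD _ vD) => // i Y Y'; have [] := hPN i Y Y'.
- by apply: mu_case => // Y t; apply: taylor_lam_rigid.
- case qx : (q x) => [i|m]; last first.
    by apply: mu_case => // Y t ht; right; apply: spine_taylor ht; apply: spine_env sG qx.
  have e : Nf (Mu b (Lam (Var 0))) = Nf (Mu b (Lam (Lam (Var 0)))).
    apply: (spine_not_const (f := f) (g := S \o g) sG qx (@Nf_lhapps_mu b)) => Y Y'.
    by have := hG i Y Y'; rewrite /= !(eq_lsub (nups_env q f g _)).
  by case: Nf_id_neq; apply: Nf_mu_inj e => t; apply: taylor_lam_rigid.
Qed.

(** * From applied abstractions to environments *)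

Definition consq (q : nat -> I + nat) (j : I) : nat -> I + nat := scons (inl j) q.

Lemma env_consq q Z j : scons (Z j) (env q id id Z) =1 env (consq q j) id id Z.
Proof. by move=> [|i] //=; rewrite /env /= lren_id. Qed.

(** The abstractions are contracted in head position, and each argument pushes the earlier ones one
    index up: the last argument is variable 0, whence the [foldl]. *)
Lemma apps_lams (js : seq I) F Z q s : s =1 env q id id Z ->
  lhapps (apps (lsub s (lams (size js) F)) [seq Z j | j <- js])
         (lsub (env (foldl consq q js) id id Z) F).
Proof.
elim: js q s => [|j js IH] q s es; first by rewrite /= (eq_lsub es); apply: lhapps_refl.
have happs P P' Ns : lhapp P P' -> lhapp (apps P Ns) (apps P' Ns).
  by elim: Ns P P' => //= N Ns IHN P P' h; apply/IHN/lhapp_app.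
rewrite /= -/(apps _ _).
apply: (@lhapps_cons _ (apps (lsub (scons (Z j) s) (lams (size js) F)) [seq Z j | j <- js])).
  by apply: happs; rewrite -lgsub_scons; apply: lhapp_lam.
apply: IH => i; rewrite -env_consq; case: i => //= i; exact: es.
Qed.

End Perpendicular.

Theorem theorem4p4 (n : nat) (F : lterm)
    (M : 'I_n.+1 -> 'I_n.+1 -> lterm) (N : 'I_n.+1 -> lterm) :
  (forall (Z : lterm) (i : 'I_n.+1),
     taylor_eq
       (apps (lams n.+1 F)
             [seq (if j == i then Z else M i j) | j <- enum 'I_n.+1])
       (N i)) ->
  forall Z : 'I_n.+1 -> lterm,
    taylor_eq (apps (lams n.+1 F) [seq Z j | j <- enum 'I_n.+1]) (N ord0).
Proof.
(* Starting from [inr], the free variables of [F] beyond the z_j stand for themselves once the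
   abstractions are removed. *)
pose q : nat -> 'I_n.+1 + nat := foldl (@consq _) inr (enum 'I_n.+1).
have eF Z : NF (taylor (apps (lams n.+1 F) [seq Z j | j <- enum 'I_n.+1])) =
            Nf (lsub (env q id id Z) F).
  rewrite NF_taylor; apply: Nf_lhapps.
  have := @apps_lams _ (enum 'I_n.+1) F Z inr Var (fun=> erefl).
  by rewrite size_enum_ord lsub_id.
rewrite /taylor_eq => h Z.
have hc : line_const M F q id id by move=> i Y Y'; rewrite -!eF !h.
(* [N ord0] is replaced by the value at a point of its line; [Var 0] is an arbitrary choice of that
   point. *)
rewrite -(h (Var 0)) (eF (line M ord0 (Var 0))) eF.
by apply/seteqP; split=> u; apply: (line_const_const hc).
Qed.
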